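(* Let $n\in\mathbb{N}$ and let $Q(z)$ be an $n\times n$ matrix function that is meromorphic on $\bar{\mathbb{C}}$, with characteristic function $\chi(z):=\det Q(z)\not\equiv 0$. Then there exist a diagonal $n\times n$ matrix function $\tilde D(z)$ and two invertible $n\times n$ matrix polynomials $S(z)$ and $T(z)$, each with constant determinant, such that $$\tilde D(z)=S(z)\,Q(z)\,T(z),$$ where $$\tilde D(z)=\operatorname{diag}\left[\tilde d_1(z),\ldots,\tilde d_n(z)\right],\qquad \tilde d_i(z)=\frac{\tilde p_i(z)}{\tilde q_i(z)},\quad i=1,\ldots,n,$$ with $\tilde p_i(z)$ and $\tilde q_i(z)$ scalar polynomials. The function $\tilde D(z)$ is uniquely determined up to the ordering of the functions $\tilde d_i(z)$ on the main diagonal and multiplication of the functions $\tilde d_i(z)$ by constants.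
   Context: $\bar{\mathbb{C}}:=\mathbb{C}\cup\{\infty\}$ is the extended complex plane. A matrix function is meromorphic on $\bar{\mathbb{C}}$ if it is holomorphic there except for isolated singularities that are poles (the point $\infty$ is either a point of holomorphy or a pole). A matrix polynomial is a matrix whose entries are polynomials in $z$ with complex coefficients. The constant determinants of $S(z)$ and $T(z)$ are nonzero.
   Formalization: Uniqueness of D̃ is claimed only among diagonal forms in which, for any two d̃_i, one divides the other with polynomial quotient (existence gives such a form); without this it fails: diag(z, z+1) and diag(1, z(z+1)) are both forms of the same Q. *)

(* Defs.v *)
From HB Require Import structures.
From mathcomp Require Import all_boot all_order all_algebra.
From mathcomp Require Import perm complex.
From mathcomp Require Import boolp classical_sets reals topology normedtype.
From mathcomp Require Import derive.

Set Implicit Arguments.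
Unset Strict Implicit.
Unset Printing Implicit Defensive.

Import Order.TTheory GRing.Theory Num.Theory numFieldNormedType.Exports.

Local Open Scope classical_set_scope.
Local Open Scope ring_scope.

(* The complex plane is R[i] for a realType R; the alias R[i]^o carries its
   structure of normed space over itself, so that [derivable _ z 1] is complex
   differentiability at z. *)

Section ScalarFunctions.
Variable R : realType.
Implicit Types (f : R[i] -> R[i]) (a : R[i]).

Definition holomorphic_at f a : Prop :=
  \forall z \near (a : R[i]^o),
    derivable (f : R[i]^o -> R[i]^o) (z : R[i]^o) 1.

Definition isolated_singularity_at f a : Prop :=
  \forall z \near (a : R[i]^o)^',
    derivable (f : R[i]^o -> R[i]^o) (z : R[i]^o) 1.

Definition pole_at f a : Prop :=
  isolated_singularity_at f a /\
  (`|f z| @[z --> (a : R[i]^o)^'] --> +oo).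

(* f is holomorphic at a once its value at a is suitably redefined *)
Definition removable_at f a : Prop :=
  exists g : R[i] -> R[i],
    holomorphic_at g a /\ \forall z \near (a : R[i]^o)^', g z = f z.

End ScalarFunctions.

Section MatrixFunctions.
Variables (R : realType) (n : nat).
Implicit Types (Q : R[i] -> 'M[R[i]]_n) (a : R[i]).

Definition mx_holomorphic_at Q a : Prop :=
  forall i j, holomorphic_at (fun z => Q z i j) a.

Definition mx_removable_at Q a : Prop :=
  forall i j, removable_at (fun z => Q z i j) a.

(* Functions are total: the value of Q at a pole is arbitrary, also for the
   entries of Q whose own singularity there is removable. *)
Definition mx_pole_at Q a : Prop :=
  (forall i j, removable_at (fun z => Q z i j) a \/
               pole_at (fun z => Q z i j) a) /\
  (exists i j, pole_at (fun z => Q z i j) a).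

(* The point at infinity is studied in the chart z = w^-1 at w = 0; since Q is
   only given on the finite plane, holomorphy at infinity means that w = 0 is a
   removable singularity. *)
Definition mx_meromorphic_on_extended_plane Q : Prop :=
  (forall a, mx_holomorphic_at Q a \/ mx_pole_at Q a) /\
  (mx_removable_at (fun w => Q w^-1) 0 \/ mx_pole_at (fun w => Q w^-1) 0).

(* det Q(z) is not identically zero as a meromorphic function *)
Definition det_not_identically_zero Q : Prop :=
  exists z, mx_holomorphic_at Q z /\ \det (Q z) != 0.

End MatrixFunctions.

Section DiagonalForm.
Variables (R : realType) (n : nat).
Local Notation C := R[i].
Implicit Types (Q : C -> 'M[C]_n) (p q : 'I_n -> {poly C}).

Definition mx_horner (S : 'M[{poly C}]_n) (z : C) : 'M[C]_n :=
  map_mx (fun s : {poly C} => s.[z]) S.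

Definition const_nonzero_det (S : 'M[{poly C}]_n) : Prop :=
  exists2 c : C, c != 0 & \det S = c%:P.

Definition ratfun (p q : {poly C}) (z : C) : C := p.[z] / q.[z].

Definition diag_fun p q (z : C) : 'M[C]_n :=
  diag_mx (\row_i ratfun (p i) (q i) z).

(* The identity D = S Q T of meromorphic functions is required where Q is
   holomorphic and no denominator of D vanishes. *)
Definition diagonal_form Q p q : Prop :=
  (forall i, q i != 0) /\
  exists S T : 'M[{poly C}]_n,
    [/\ const_nonzero_det S, const_nonzero_det T &
        forall z, mx_holomorphic_at Q z -> (forall i, (q i).[z] != 0) ->
          diag_fun p q z = mx_horner S z *m Q z *m mx_horner T z].

(* p2/q2 = r * (p1/q1) for some polynomial r, denominators cleared *)
Definition ratfun_dvd (p1 q1 p2 q2 : {poly C}) : Prop :=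
  exists r : {poly C}, p2 * q1 = r * (p1 * q2).

(* The Smith-McMillan normalization in a form that does not depend on the order
   of the diagonal entries: any two are comparable for divisibility, i.e. some
   reordering is a divisibility chain.  Without it the diagonal form is not
   unique: diag(z, z + 1) and diag(1, z (z + 1)) are diagonal forms of the same
   matrix function. *)
Definition divisibility_chain p q : Prop :=
  forall i j, ratfun_dvd (p i) (q i) (p j) (q j) \/
              ratfun_dvd (p j) (q j) (p i) (q i).

Definition same_up_to_order_and_constants p q p' q' : Prop :=
  exists (s : 'S_n) (c : 'I_n -> C),
    (forall i, c i != 0) /\
    forall i z, (q (s i)).[z] != 0 -> (q' i).[z] != 0 ->
      ratfun (p' i) (q' i) z = c i * ratfun (p (s i)) (q (s i)) z.

End DiagonalForm.

(* Main.v *)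
Require Import Defs.
From mathcomp Require Import all_boot all_order all_algebra.
From mathcomp Require Import perm complex.
From mathcomp Require Import boolp classical_sets reals topology normedtype.
From mathcomp Require Import sequences derive.
From mathcomp Require Import zify ring lra.

(** The proof has an analytic half and an algebraic half.

    Analysis: a function that is meromorphic on the extended plane is rational
    ([meromorphic_matrix_rational]).  Its finitely many poles are cancelled by
    a polynomial q, the product is entire and grows at most like a power of z,
    so it is a polynomial by the Liouville theorem ([liouville]).  Everything
    this uses about holomorphic functions comes out of one estimate,
    [cauchy_bound]: if f is differentiable on a disc of radius 2r and bounded
    by M on the annulus from r to 2r, then it is bounded by 18 M on the disc of
    radius r/2.  In its proof the contour integral along a segment is
    replaced by its trapezoid sums with 2^N pieces ([tmean]); these
    are additive under halving of the segment by construction, so the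
    bisection argument of Goursat shows that they tend to 0 along a triangle
    on which f is differentiable ([goursat]).  Applied to the difference
    quotient (f(z) - f(b)) / (z - b) on the four triangles that join b to the
    sides of a square, this yields the bound, because the trapezoid sums of
    1 / (z - b) along the square stay away from 0 ([edge_winding]).

    Taking powers of f removes the constant 18, and a polynomial factor that
    vanishes at finitely many points makes those points harmless
    ([max_principle_off]).  Applied again to the difference quotient, this
    shows that f is Lipschitz near a singularity where it is bounded, whence
    the Riemann extension theorem ([riemann_removable]).  A pole has finite
    order ([pole_finite_order]) because the reciprocal of f extends, and a
    zero of infinite order contradicts the Cauchy bound.

    Algebra: write Q = P / q with P a polynomial matrix.  The Smith form of P
    ([smith_form]) divided by q is the required diagonal form; conversely every
    diagonal form of Q is, up to the denominator q, a diagonal form of P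
    ([diagonal_form_polynomial]).  Existence follows by looking at an entry of
    least size among all matrices equivalent to P.  Uniqueness
    ([smith_form_unique]) compares two sorted divisibility chains d and e: if
    diag e = X diag d Y, then modulo d_k the first k + 1 rows and columns only
    see k entries of d, so a determinant of size k + 1 vanishes and forces d_k
    to divide e_k ([diag_factor_dvdp]). *)

Set Implicit Arguments.
Unset Strict Implicit.
Unset Printing Implicit Defensive.

Import Order.TTheory GRing.Theory Num.Theory numFieldNormedType.Exports.

Local Open Scope classical_set_scope.
Local Open Scope ring_scope.

(** * Modulus and complex differentiability *)

Section Modulus.
Variable R : realType.
Implicit Types (x y z : R[i]) (k : R).

(** The norm of R[i] takes values in R[i]; this is the same number as an element of R, where
    the order is total. *)
Definition cmod z : R := complex.Re `|z|.

Lemma cmodE z : (cmod z)%:C%C = `|z|.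
Proof. by rewrite /cmod RRe_real // normr_real. Qed.

Lemma cmod_ge0 z : 0 <= cmod z.
Proof. by rewrite -lecR cmodE normr_ge0. Qed.

Lemma cmodM x y : cmod (x * y) = cmod x * cmod y.
Proof. by apply: complexI; rewrite rmorphM /= !cmodE normrM. Qed.

Lemma cmodN x : cmod (- x) = cmod x.
Proof. by rewrite /cmod normrN. Qed.

Lemma cmodC x y : cmod (x - y) = cmod (y - x).
Proof. by rewrite /cmod distrC. Qed.

Lemma cmodD x y : cmod (x + y) <= cmod x + cmod y.
Proof. by rewrite -lecR rmorphD /= !cmodE ler_normD. Qed.

Lemma cmodB x y : cmod (x - y) <= cmod x + cmod y.
Proof. by rewrite -(cmodN y) cmodD. Qed.

Lemma cmod_tri y x z : cmod (x - z) <= cmod (x - y) + cmod (y - z).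
Proof. by apply: le_trans (cmodD _ _); rewrite addrA subrK. Qed.

Lemma cmod_eq0 x : (cmod x == 0) = (x == 0).
Proof. by rewrite -(inj_eq (@complexI R)) /= cmodE normr_eq0. Qed.

Lemma cmod0 : cmod 0 = 0. Proof. by apply/eqP; rewrite cmod_eq0. Qed.

Lemma cmod_gt0 x : (0 < cmod x) = (x != 0).
Proof. by rewrite lt_def cmod_eq0 cmod_ge0 andbT. Qed.

Lemma cmod1 : cmod 1 = 1.
Proof. by rewrite /cmod normr1. Qed.

Lemma cmodV x : cmod x^-1 = (cmod x)^-1.
Proof.
have [->|x0] := eqVneq x 0; first by rewrite invr0 cmod0 invr0.
have c0 : cmod x != 0 by rewrite cmod_eq0.
by apply: (mulfI c0); rewrite -cmodM !mulfV // cmod1.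
Qed.

Lemma cmodX x n : cmod (x ^+ n) = cmod x ^+ n.
Proof.
elim: n => [|n IH]; last by rewrite !exprS cmodM IH.
by rewrite !expr0 cmod1.
Qed.

Lemma cmodR k : cmod k%:C%C = `|k|.
Proof.
apply: complexI; rewrite cmodE normc_def /=.
by rewrite expr0n addr0 sqrtr_sqr.
Qed.

Lemma Re_le_cmod z : `|complex.Re z| <= cmod z.
Proof. by rewrite -lecR cmodE normc_ge_Re. Qed.

Lemma cmod_i : cmod ('i%C : R[i]) = 1.
Proof. by rewrite /cmod normc_def /= expr0n expr1n add0r sqrtr1. Qed.

Lemma Im_le_cmod z : `|complex.Im z| <= cmod z.
Proof.
have := Re_le_cmod (z * 'i%C); rewrite ReiNIm normrN cmodM => /le_trans; apply.
by rewrite cmod_i mulr1.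
Qed.

Lemma cmod_le_ReIm z : cmod z <= `|complex.Re z| + `|complex.Im z|.
Proof.
rewrite {1}(complexE z); apply: le_trans (cmodD _ _) _.
by rewrite cmodM !cmodR cmod_i mul1r.
Qed.

Lemma nbhs_cmodP (a : R[i]) (P : R[i] -> Prop) :
  (\forall z \near (a : R[i]^o), P z) <->
  exists2 d : R, 0 < d & forall z, cmod (z - a) < d -> P z.
Proof.
split.
  move=> /nbhs_ballP [e /= e0 he].
  have eE : (complex.Re e)%:C%C = e by rewrite RRe_real // gtr0_real.
  exists (complex.Re e); first by rewrite -ltcR eE.
  move=> z hz; apply: he; rewrite /ball /= -eE distrC -cmodE ltcR //.
move=> [d d0 hd]; apply/nbhs_ballP; exists (d%:C%C); first by rewrite /= ltcR.
by move=> z; rewrite /ball /= distrC -cmodE ltcR; apply: hd.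
Qed.

Lemma dnbhs_cmodP (a : R[i]) (P : R[i] -> Prop) :
  (\forall z \near (a : R[i]^o)^', P z) <->
  exists2 d : R, 0 < d & forall z, 0 < cmod (z - a) -> cmod (z - a) < d -> P z.
Proof.
rewrite /dnbhs /within /=; split.
  move=> /nbhs_cmodP [d d0 h]; exists d => // z z0 zd.
  by apply: h => //; rewrite -subr_eq0 -cmod_gt0.
move=> [d d0 h]; apply/nbhs_cmodP; exists d => // z zd za.
by apply: h => //; rewrite cmod_gt0 subr_eq0.
Qed.

Definition cderivable (f : R[i] -> R[i]) (a : R[i]) : Prop :=
  derivable (f : R[i]^o -> R[i]^o) (a : R[i]^o) 1.

Lemma cderivableP (f : R[i] -> R[i]) (a : R[i]) :
  cderivable f a <->
  exists l, forall e : R, 0 < e -> exists2 d : R, 0 < d &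
    forall z, cmod (z - a) < d ->
      cmod (f z - f a - l * (z - a)) <= e * cmod (z - a).
Proof.
split.
  move=> /cvg_ex[/= l /cvgrPdist_le hl]; exists l => e e0.
  have /dnbhs_cmodP[d d0 hd] := hl e%:C%C ltac:(by rewrite ltcR).
  exists d => // z hz; have [->|za] := eqVneq z a.
    by rewrite !subrr mulr0 subr0 cmod0 mulr0.
  have z0 : z - a != 0 by rewrite subr_eq0.
  have := hd (z - a); rewrite subr0 cmod_gt0 => /(_ z0 hz).
  rewrite -cmodE lecR /shift /= /GRing.scale /= mulr1 subrK => h.
  have -> : f z - f a - l * (z - a) = - (l - (z - a)^-1 * (f z - f a)) * (z - a).
    by field.
  by rewrite cmodM cmodN ler_wpM2r // cmod_ge0.
move=> [l hl]; apply/cvg_ex; exists l; apply/cvgrPdist_le => /= e e0.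
have eE : (complex.Re e)%:C%C = e by rewrite RRe_real // gtr0_real.
have [|d d0 hd] := hl (complex.Re e); first by rewrite -ltcR eE.
apply/dnbhs_cmodP; exists d => // h; rewrite subr0 => h0 hltd.
rewrite -eE -cmodE lecR /shift /= /GRing.scale /= mulr1.
have := hd (h + a); rewrite addrK => /(_ hltd) H.
have hn0 : h != 0 by rewrite -cmod_gt0.
have -> : l - h^-1 * (f (h + a) - f a) = - (f (h + a) - f a - l * h) * h^-1.
  by field.
by rewrite cmodM cmodN cmodV ler_pdivrMr.
Qed.

End Modulus.

(** * Dyadic limits and bisection *)

Section Bisection.
Variable R : realType.
Implicit Types (L : R).

(** The intervals of radius L / 2^k around x_k are nested, and the supremum of their lower
    ends lies in all of them. *)
Lemma dyadic_limitR (x : nat -> R) L :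
  (forall k, `|x k.+1 - x k| <= L / 2 ^+ k.+1) ->
  exists s, forall k, `|x k - s| <= L / 2 ^+ k.
Proof.
move=> h.
have hE k : L / 2 ^+ k.+1 = L / 2 ^+ k / 2 by rewrite exprS invfM mulrA mulrAC.
pose lo k := x k - L / 2 ^+ k; pose hi k := x k + L / 2 ^+ k.
have loS k : lo k <= lo k.+1.
  by have := h k; rewrite /lo hE ler_norml => /andP[]; lra.
have hiS k : hi k.+1 <= hi k.
  by have := h k; rewrite /hi hE ler_norml => /andP[]; lra.
have lohi k : lo k <= hi k.
  have := le_trans (normr_ge0 _) (h k); rewrite hE /lo /hi; lra.
have lom := homo_leq (@lexx _ R) (@le_trans _ R) loS.
have him : {homo hi : i j / (i <= j)%N >-> j <= i}.
  by apply: homo_leq => // u v w vu wv; apply: le_trans vu.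
have lh i j : lo i <= hi j.
  have [ij|/ltnW ji] := leqP i j; first exact: le_trans (lom _ _ ij) (lohi j).
  exact: le_trans (lohi i) (him _ _ ji).
exists (sup (range lo)) => k.
have hsup : has_sup (range lo).
  split; first by exists (lo 0%N); exists 0%N.
  by exists (hi 0%N) => _ [i _ <-]; apply: lh.
have h1 : lo k <= sup (range lo).
  by apply: ub_le_sup; [case: hsup | exists k].
have h2 : sup (range lo) <= hi k.
  by apply: ge_sup; [case: hsup | move=> _ [i _ <-]; apply: lh].
rewrite ler_norml; move: h1 h2; rewrite /lo /hi; lra.
Qed.

Lemma dyadic_limit (a : nat -> R[i]) L :
  (forall k, cmod (a k.+1 - a k) <= L / 2 ^+ k.+1) ->
  exists z, forall k, cmod (a k - z) <= 2 * (L / 2 ^+ k).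
Proof.
move=> h.
have [|x hx] := @dyadic_limitR (fun k => complex.Re (a k)) L.
  by move=> k; rewrite -raddfB; apply: le_trans (Re_le_cmod _) (h k).
have [|y hy] := @dyadic_limitR (fun k => complex.Im (a k)) L.
  by move=> k; rewrite -raddfB; apply: le_trans (Im_le_cmod _) (h k).
exists (Complex x y) => k; apply: le_trans (cmod_le_ReIm _) _.
have := hx k; have := hy k; case: (a k) => u v /=; lra.
Qed.

Lemma dyadic_small (x e : R) : 0 < e -> exists k, x / 2 ^+ k < e.
Proof.
move=> e0; have [k hk] : exists k, x / e < 2 ^+ k.
  exists (Num.bound (x / e)); have [x0|x0] := leP 0 (x / e).
    apply: lt_le_trans (archi_boundP x0) _.
    by rewrite -natrX ler_nat ltnW // ltn_expl.
  by apply: lt_le_trans x0 _; rewrite exprn_ge0.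
by exists k; rewrite ltr_pdivrMr ?exprn_gt0 // mulrC -ltr_pdivrMr.
Qed.

(** The argument behind both Goursat and Bolzano-Weierstrass: if P failed for t, it would
    fail along a sequence of children whose diameters are halved; their anchors converge, and
    P holds for all small cells near the limit. *)
Lemma bisection (T : Type) (anchor : T -> R[i]) (diam : T -> R)
    (child : T -> T -> Prop) (P : T -> Prop) :
  (forall t t', child t t' -> diam t' = diam t / 2 /\
      cmod (anchor t' - anchor t) <= diam t / 2) ->
  (forall t, (forall t', child t t' -> P t') -> P t) ->
  (forall z, exists2 d : R, 0 < d & forall t,
      cmod (anchor t - z) <= 2 * diam t -> diam t < d -> P t) ->
  forall t, P t.
Proof.
move=> hch hsplit hloc t; apply: contrapT => nPt.
have step (s : {s | ~ P s}) : {s' : {s | ~ P s} | child (sval s) (sval s')}.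
  apply: cid; apply: contrapT => hn; apply: (svalP s); apply: hsplit => t' ct'.
  by apply: contrapT => nP'; apply: hn; exists (exist _ t' nP').
pose s k := iter k (fun s => sval (step s)) (exist _ t nPt).
have hs k : child (sval (s k)) (sval (s k.+1)) by apply: (svalP (step (s k))).
have hd k : diam (sval (s k)) = diam t / 2 ^+ k.
  elim: k => [|k IH]; first by rewrite expr0 divr1.
  by have [-> _] := hch _ _ (hs k); rewrite IH exprS invfM mulrA mulrAC.
have [|z hz] := @dyadic_limit (fun k => anchor (sval (s k))) (diam t).
  move=> k; have [_] := hch _ _ (hs k).
  by rewrite hd exprS invfM mulrA mulrAC.
have [d d0 hP] := hloc z.
have [k hk] := dyadic_small (diam t) d0.
by apply: (svalP (s k)); apply: hP; rewrite hd.
Qed.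

End Bisection.

(** * Trapezoid means on segments *)

Section TrapezoidMeans.
Variable R : realType.
Local Notation C := R[i].
Implicit Types (f g : C -> C) (u v w : C) (N : nat).

Definition mid u v : C := (u + v) / 2.

Lemma midC u v : mid u v = mid v u. Proof. by rewrite /mid addrC. Qed.

(** The mean of f given by the trapezoid rule with 2^N equal pieces of the segment [u, v];
    (v - u) * tmean f N u v stands for the contour integral along the segment. *)
Fixpoint tmean f N u v : C :=
  if N is N'.+1 then mid (tmean f N' u (mid u v)) (tmean f N' (mid u v) v)
  else mid (f u) (f v).

Definition midclosed (D : C -> Prop) :=
  forall u v, D u -> D v -> D (mid u v).

Lemma tmeanC f N u v : tmean f N u v = tmean f N v u.
Proof.
elim: N u v => [|N IH] u v /=; first exact: midC.
by rewrite midC (midC v u) IH (IH u).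
Qed.

(** All the sample points are obtained from u and v by repeated halving, and so is the mean
    from the sampled values; so closure of D and K under midpoints transfers f(D) in K to the
    mean. *)
Lemma tmean_mem (D K : C -> Prop) f N u v :
  midclosed D -> midclosed K -> (forall z, D z -> K (f z)) ->
  D u -> D v -> K (tmean f N u v).
Proof.
move=> mD mK hf; elim: N u v => [|N IH] u v Du Dv /=.
  by apply: mK; apply: hf.
by have Dm := mD _ _ Du Dv; apply: mK; apply: IH.
Qed.

Lemma tmeanD f g N u v :
  tmean (fun z => f z + g z) N u v = tmean f N u v + tmean g N u v.
Proof.
elim: N u v => [|N IH] u v /=; first by rewrite /mid; field.
by rewrite !IH /mid; field.
Qed.

Lemma tmeanZ (k : C) f N u v :
  tmean (fun z => k * f z) N u v = k * tmean f N u v.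
Proof.
elim: N u v => [|N IH] u v /=; first by rewrite /mid; field.
by rewrite !IH /mid; field.
Qed.

Lemma eq_tmean f g N u v : f =1 g -> tmean f N u v = tmean g N u v.
Proof.
by move=> fg; elim: N u v => [|N IH] u v /=; rewrite ?fg ?IH.
Qed.

(** The trapezoid rule is exact for affine functions, which is why the linear part of f drops
    out of the sums along closed triangles. *)
Lemma tmean_affine (k l : C) N u v :
  tmean (fun z => k * z + l) N u v = k * mid u v + l.
Proof.
elim: N u v => [|N IH] u v /=; first by rewrite /mid; field.
by rewrite !IH /mid; field.
Qed.

Lemma midclosed_cmod (c : C) (e : R) : midclosed (fun z => cmod (z - c) <= e).
Proof.
move=> u v hu hv; rewrite /mid.
have -> : (u + v) / 2 - c = (2^-1)%:C%C * ((u - c) + (v - c)).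
  by rewrite fmorphV rmorphMn /= rmorph1; field.
rewrite cmodM cmodR ger0_norm ?invr_ge0 //.
have := cmodD (u - c) (v - c); lra.
Qed.

Lemma Re_mid (k u v : C) :
  complex.Re (k * mid u v) = (complex.Re (k * u) + complex.Re (k * v)) / 2.
Proof.
have -> : k * mid u v = (2^-1)%:C%C * (k * u + k * v).
  by rewrite fmorphV rmorphMn /= rmorph1 /mid; field.
by case: (k * u) (k * v) => [a b] [c d] /=; ring.
Qed.

Lemma midclosed_Re (k : C) (e : R) : midclosed (fun z => complex.Re (k * z) <= e).
Proof. by move=> u v hu hv; rewrite Re_mid; lra. Qed.

Lemma cmod_tmean (D : C -> Prop) f N u v (e : R) :
  midclosed D -> (forall z, D z -> cmod (f z) <= e) ->
  D u -> D v -> cmod (tmean f N u v) <= e.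
Proof.
move=> mD hf Du Dv.
have := @tmean_mem D (fun z => cmod (z - 0) <= e) f N u v mD
  (@midclosed_cmod 0 e).
by rewrite subr0; apply=> // z /hf; rewrite subr0.
Qed.

End TrapezoidMeans.

(** * The Goursat theorem on triangles *)

Section Goursat.
Variable R : realType.
Local Notation C := R[i].
Implicit Types (f g : C -> C) (a b c u v z : C) (N : nat).

Definition trisum f N a b c : C :=
  (b - a) * tmean f N a b + (c - b) * tmean f N b c + (a - c) * tmean f N c a.

Definition perim a b c : R := cmod (b - a) + cmod (c - b) + cmod (a - c).

(** The closed convex hull, as an intersection of half-planes. *)
Definition hull (s : seq C) z : Prop :=
  forall (k : C) (e : R),
    (forall x, x \in s -> complex.Re (k * x) <= e) -> complex.Re (k * z) <= e.

Lemma mem_hull s x : x \in s -> hull s x.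
Proof. by move=> xs k e; apply. Qed.

Lemma midclosed_hull s : midclosed (hull s).
Proof.
by move=> u v hu hv k e h; apply: (@midclosed_Re _ k e); [apply: hu|apply: hv].
Qed.

Lemma hull_subset s t : (forall x, x \in s -> hull t x) ->
  forall z, hull s z -> hull t z.
Proof. by move=> st z hz k e h; apply: hz => x /st; apply. Qed.

Lemma perim_ge0 a b c : 0 <= perim a b c.
Proof. by rewrite !addr_ge0 ?cmod_ge0. Qed.

(** The exact discrete form of the additivity of contour integrals: one more level of the
    trapezoid rule on the triangle is the previous level on its four quarters, the inner sides
    being traversed twice in opposite directions. *)
Lemma trisumS f N a b c :
  trisum f N.+1 a b c =
    trisum f N a (mid a b) (mid c a) + trisum f N (mid a b) b (mid b c) +
    trisum f N (mid c a) (mid b c) c + trisum f N (mid b c) (mid c a) (mid a b).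
Proof.
rewrite /trisum /= (tmeanC f N (mid b c) (mid c a)).
rewrite (tmeanC f N (mid c a) (mid a b)) (tmeanC f N (mid a b) (mid b c)).
by rewrite /mid; field.
Qed.

Lemma trisumD f g N a b c :
  trisum (fun z => f z + g z) N a b c = trisum f N a b c + trisum g N a b c.
Proof. by rewrite /trisum !tmeanD; ring. Qed.

Lemma eq_trisum f g N a b c : f =1 g -> trisum f N a b c = trisum g N a b c.
Proof. by move=> fg; rewrite /trisum !(eq_tmean _ _ _ fg). Qed.

Lemma trisum_affine (k l : C) N a b c : trisum (fun z => k * z + l) N a b c = 0.
Proof. by rewrite /trisum !tmean_affine /mid; field. Qed.

Lemma cmod_trisum (D : C -> Prop) f N a b c (e : R) :
  midclosed D -> (forall z, D z -> cmod (f z) <= e) -> D a -> D b -> D c ->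
  cmod (trisum f N a b c) <= perim a b c * e.
Proof.
move=> mD hf Da Db Dc; rewrite /perim !mulrDl /trisum.
have H u v : D u -> D v -> cmod ((v - u) * tmean f N u v) <= cmod (v - u) * e.
  by move=> Du Dv; rewrite cmodM ler_wpM2l ?cmod_ge0 // (cmod_tmean _ mD hf).
apply: le_trans (cmodD _ _) _; apply: lerD; last exact: H.
by apply: le_trans (cmodD _ _) _; apply: lerD; apply: H.
Qed.

(** Bounds that hold for all large N replace limits of the sums, so that the convergence of
    the trapezoid sums never has to be established. *)
Definition eventually_le f a b c (e : R) :=
  exists N0, forall N, (N0 <= N)%N -> cmod (trisum f N a b c) <= e.

Lemma eventually_le_split f a b c (e1 e2 e3 e4 : R) :
  eventually_le f a (mid a b) (mid c a) e1 -> eventually_le f (mid a b) b (mid b c) e2 ->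
  eventually_le f (mid c a) (mid b c) c e3 -> eventually_le f (mid b c) (mid c a) (mid a b) e4 ->
  eventually_le f a b c (e1 + e2 + e3 + e4).
Proof.
move=> [N1 h1] [N2 h2] [N3 h3] [N4 h4].
exists (N1 + N2 + N3 + N4).+1 => -[//|N] hN; rewrite trisumS.
have {}h1 := h1 N ltac:(lia); have {}h2 := h2 N ltac:(lia).
have {}h3 := h3 N ltac:(lia); have {}h4 := h4 N ltac:(lia).
apply: le_trans (cmodD _ _) _; apply: lerD => //.
apply: le_trans (cmodD _ _) _; apply: lerD => //.
by apply: le_trans (cmodD _ _) _; apply: lerD.
Qed.

Lemma cmod_half z : cmod (z / 2) = cmod z / 2.
Proof.
have -> : z / 2 = (2^-1)%:C%C * z by rewrite fmorphV rmorphMn /= rmorph1 mulrC.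
by rewrite cmodM cmodR ger0_norm ?invr_ge0 // mulrC.
Qed.

Lemma mid_subl a b : mid a b - a = (b - a) / 2.
Proof. by rewrite /mid; field. Qed.

Lemma perim_half a b c a' b' c' :
  b' - a' = (b - a) / 2 -> c' - b' = (c - b) / 2 -> a' - c' = (a - c) / 2 ->
  perim a' b' c' = perim a b c / 2.
Proof. by rewrite /perim => -> -> ->; rewrite !cmod_half; lra. Qed.

Lemma perim_mid a b c :
  [/\ perim a (mid a b) (mid c a) = perim a b c / 2,
      perim (mid a b) b (mid b c) = perim a b c / 2,
      perim (mid c a) (mid b c) c = perim a b c / 2 &
      perim (mid b c) (mid c a) (mid a b) = perim a b c / 2].
Proof.
split; rewrite /mid; try by apply: perim_half; field.
have -> : perim a b c = perim (- a) (- b) (- c).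
  by rewrite /perim -!opprD !cmodN.
by apply: perim_half; field.
Qed.

(** Near a point of differentiability only the error term of the linear approximation
    contributes, and it is small compared with the size of the triangle. *)
Lemma goursat_near f (l z0 : C) (e rho : R) N a b c :
  (forall z, cmod (z - z0) <= rho ->
     cmod (f z - f z0 - l * (z - z0)) <= e * cmod (z - z0)) ->
  0 <= e -> cmod (a - z0) <= rho -> cmod (b - z0) <= rho ->
  cmod (c - z0) <= rho ->
  cmod (trisum f N a b c) <= perim a b c * (e * rho).
Proof.
move=> hf e0 ha hb hc.
pose g z := f z - f z0 - l * (z - z0).
rewrite (_ : trisum f N a b c = trisum g N a b c); last first.
  rewrite -[RHS]addr0 -(trisum_affine l (f z0 - l * z0) N a b c) -trisumD.
  by apply: eq_trisum => z; rewrite /g; ring.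
apply: (@cmod_trisum (fun z => cmod (z - z0) <= rho)) => //.
  exact: midclosed_cmod.
by move=> z hz; apply: le_trans (hf _ hz) _; rewrite ler_wpM2l.
Qed.

(** Goursat by bisection, for the bound e * perim^2: it is inherited from the quarters of a
    triangle, and it holds for the small triangles near each point of the hull. *)
Lemma goursat f a b c :
  (forall z, hull [:: a; b; c] z -> cderivable f z) ->
  forall e : R, 0 < e -> eventually_le f a b c e.
Proof.
move=> hf.
pose H := hull [:: a; b; c].
have mH : midclosed H by apply: midclosed_hull.
suff main (e : R) : 0 < e -> eventually_le f a b c (e * perim a b c ^+ 2).
  move=> e e0; have L0 := perim_ge0 a b c.
  have d0 : 0 < perim a b c ^+ 2 + 1 by nra.
  have [N hN] := main (e / (perim a b c ^+ 2 + 1)) ltac:(by rewrite divr_gt0).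
  exists N => n /hN /le_trans; apply.
  by rewrite mulrAC ler_pdivrMr // ler_wpM2l ?ltW //; lra.
move=> e0.
pose T := (C * C * C)%type.
pose P (t : T) := let: (a, b, c) := t in
  H a -> H b -> H c -> eventually_le f a b c (e * perim a b c ^+ 2).
pose child (t t' : T) := let: (a, b, c) := t in
  [\/ t' = (a, mid a b, mid c a), t' = (mid a b, b, mid b c),
      t' = (mid c a, mid b c, c) | t' = (mid b c, mid c a, mid a b)].
pose diam (t : T) := let: (a, b, c) := t in perim a b c.
suff : P (a, b, c).
  by apply; apply: mem_hull; rewrite !inE eqxx ?orbT.
apply: (@bisection R T (fun t => t.1.1) diam child).
- move=> {a b c hf P H mH} [[a b] c] t' /=.
  have [p1 p2 p3 p4] := perim_mid a b c.
  case=> -> /=; split=> //.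
  + by rewrite subrr cmod0 divr_ge0 ?perim_ge0.
  + rewrite mid_subl cmod_half /perim.
    have := cmod_ge0 (c - b); have := cmod_ge0 (a - c); lra.
  + rewrite midC mid_subl cmod_half /perim (cmodC c a).
    have := cmod_ge0 (c - b); have := cmod_ge0 (b - a); lra.
  + have -> : mid b c - a = ((b - a) + (c - a)) / 2 by rewrite /mid; field.
    rewrite cmod_half /perim.
    have := cmodD (b - a) (c - a); have := cmod_ge0 (c - b).
    by rewrite (cmodC c a); lra.
- move=> {hf} [[a' b'] c']; rewrite /P {P}; move: H mH => H mH.
  move: a' b' c' => {}a {}b {}c hP Ha Hb Hc.
  have [p1 p2 p3 p4] := perim_mid a b c.
  have Hab := mH _ _ Ha Hb; have Hbc := mH _ _ Hb Hc; have Hca := mH _ _ Hc Ha.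
  have -> : e * perim a b c ^+ 2 = e * (perim a b c / 2) ^+ 2 +
    e * (perim a b c / 2) ^+ 2 + e * (perim a b c / 2) ^+ 2 +
    e * (perim a b c / 2) ^+ 2 by field.
  apply: eventually_le_split.
  + by rewrite -p1; apply: (hP (a, mid a b, mid c a)) => //; constructor 1.
  + by rewrite -p2; apply: (hP (mid a b, b, mid b c)) => //; constructor 2.
  + by rewrite -p3; apply: (hP (mid c a, mid b c, c)) => //; constructor 3.
  + by rewrite -p4; apply: (hP (mid b c, mid c a, mid a b)) => //; constructor 4.
- move=> z; have [Hz|nHz] := pselect (H z).
    have /cderivableP[l hl] := hf z Hz.
    have [d d0 hd] := hl (e / 3) ltac:(lra).
    exists (d / 3) => [|[[a' b'] c'] /= ha hdiam _ _ _]; first lra.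
    have L0 := perim_ge0 a' b' c'; set L := perim a' b' c' in ha hdiam L0 *.
    have -> : e * L ^+ 2 = L * (e / 3 * (3 * L)) by field.
    exists 0%N => N _; apply: (@goursat_near f l z).
    + by move=> y hy; apply: hd; lra.
    + lra.
    + lra.
    + have := cmod_tri a' b' z; move: (cmod_ge0 (c' - b')) (cmod_ge0 (a' - c')).
      by move: ha; rewrite /L /perim; lra.
    + have := cmod_tri a' c' z; rewrite (cmodC c' a').
      move: (cmod_ge0 (c' - b')) (cmod_ge0 (b' - a')).
      by move: ha; rewrite /L /perim; lra.
  (* The point z is outside the hull: a half-plane separates it, and no triangle of the hull
     comes near z. *)
  have [k [r [hr hz]]] : exists k r,
      (forall x, x \in [:: a; b; c] -> complex.Re (k * x) <= r) /\
      r < complex.Re (k * z).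
    apply: contrapT => hn; apply: nHz => k r hr; rewrite leNgt; apply/negP => hz.
    by apply: hn; exists k, r.
  have k1 : 0 < 2 * (cmod k + 1) by have := cmod_ge0 k; lra.
  exists ((complex.Re (k * z) - r) / (2 * (cmod k + 1))).
    by rewrite divr_gt0 // subr_gt0.
  move=> [[a' b'] c'] /= ha; rewrite ltr_pdivlMr // => hdiam Ha.
  exfalso; have := Ha k r hr; have := Re_le_cmod (k * (a' - z)).
  rewrite mulrBr raddfB /= ler_norml => /andP[h1 _] h2.
  move: h1; rewrite -mulrBr cmodM => h1.
  have := perim_ge0 a' b' c'; have := cmod_ge0 k; have := cmod_ge0 (a' - z).
  nra.
Qed.

End Goursat.

(** * Triangles with a bad vertex *)

Section PuncturedGoursat.
Variable R : realType.
Local Notation C := R[i].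
Implicit Types (f g : C -> C) (a b c u v z : C) (N : nat).

(** One vertex b may be a singularity near which f is bounded.  Cut the triangle into
    quarters: the three quarters away from b are covered by Goursat, and the quarter at b is
    treated in the same way until it is so small that the bound M makes its sum negligible.
    The functional k separates b from the opposite side. *)
Lemma goursat_vertex f b u v (k : C) (h M d : R) :
  (forall z, hull [:: b; u; v] z -> z != b -> cderivable f z) ->
  0 < d -> (forall z, cmod (z - b) < d -> cmod (f z) <= M) ->
  complex.Re (k * b) < h -> h <= complex.Re (k * u) -> h <= complex.Re (k * v) ->
  forall e : R, 0 < e -> eventually_le f b u v e.
Proof.
move=> hf d0 hM hb hu hv e e0.
have M0 : 0 <= M.
  by apply: le_trans (cmod_ge0 (f b)) (hM b _); rewrite subrr cmod0.
(* Below the perimeter rho the triangle lies in the disc where f is bounded by M, and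
   its sum is at most e / 2; the other half of e is spent on the quarters cut off. *)
pose rho := Num.min (d / 2) (e / 2 / (M + 1)).
have rho0 : 0 < rho by rewrite lt_min !divr_gt0 //; lra.
have rhod : rho < d by rewrite gt_min; apply/orP; left; lra.
have rhoM : rho * M <= e / 2.
  apply: le_trans (_ : e / 2 / (M + 1) * M <= _).
    by rewrite ler_wpM2r // ge_min lexx orbT.
  by rewrite mulrAC ler_pdivrMr; [rewrite ler_wpM2l //; lra | lra].
have [n hn] := dyadic_small (perim b u v) rho0.
have {hn} : perim b u v <= 2 ^+ n * rho.
  by move: hn; rewrite ltr_pdivrMr ?exprn_gt0 // mulrC => /ltW.
have -> : e = e / 2 + e / 2 by field.
have : 0 < e / 2 by lra.
move: {1 3}(e / 2) => eta eta0.
elim: n u v h hf hb hu hv eta eta0 => [|n IH] u v h hf hb hu hv eta eta0.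
  rewrite expr0 mul1r => hp; exists 0%N => N _.
  apply: le_trans (_ : perim b u v * M <= _).
    apply: (@cmod_trisum R (fun z => cmod (z - b) <= perim b u v)).
    - exact: midclosed_cmod.
    - by move=> z hz; apply: hM; apply: le_lt_trans hz _; apply: le_lt_trans rhod.
    - by rewrite subrr cmod0 perim_ge0.
    - by rewrite /perim; have := cmod_ge0 (v - u); have := cmod_ge0 (b - v); lra.
    - rewrite /perim (cmodC b v).
      by have := cmod_ge0 (v - u); have := cmod_ge0 (u - b); lra.
  have : perim b u v * M <= rho * M by rewrite ler_wpM2r.
  by lra.
move=> hp.
have [p1 p2 p3 p4] := perim_mid b u v.
pose H := hull [:: b; u; v].
have mH : midclosed H by apply: midclosed_hull.
have Hb : H b by apply: mem_hull; rewrite !inE eqxx ?orbT.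
have Hu : H u by apply: mem_hull; rewrite !inE eqxx ?orbT.
have Hv : H v by apply: mem_hull; rewrite !inE eqxx ?orbT.
have Hbu := mH _ _ Hb Hu; have Huv := mH _ _ Hu Hv; have Hvb := mH _ _ Hv Hb.
have sub3 x y z : H x -> H y -> H z -> forall w, hull [:: x; y; z] w -> H w.
  move=> Hx Hy Hz; apply: hull_subset => w; rewrite !inE.
  by case/or3P => /eqP ->.
(* The midpoints lie on the far side of the level h', halfway between b and the
   level h of the opposite side. *)
pose h' := (complex.Re (k * b) + h) / 2.
have far x y z : H x -> H y -> H z -> h' <= complex.Re (k * x) ->
    h' <= complex.Re (k * y) -> h' <= complex.Re (k * z) ->
    forall q : R, 0 < q -> eventually_le f x y z q.
  move=> Hx Hy Hz hx hy hz; apply: goursat => w hw.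
  apply: hf; first exact: sub3 hw.
  apply: contraTneq isT => wb; have := hw (- k) (- h').
  rewrite wb mulNr raddfN /= lerN2 => hh.
  suff: h' <= complex.Re (k * b) by rewrite /h'; lra.
  apply: hh => s; rewrite !inE => /or3P[] /eqP ->;
    by rewrite mulNr raddfN /= lerN2.
have -> : e / 2 + eta = (e / 2 + eta / 2) + eta / 6 + eta / 6 + eta / 6.
  by field.
apply: eventually_le_split.
- apply: (IH _ _ h') => //.
  + by move=> z hz; apply: hf; apply: sub3 hz.
  + by rewrite /h'; lra.
  + by rewrite Re_mid /h'; lra.
  + by rewrite Re_mid /h'; lra.
  + lra.
  + by rewrite p1; move: hp; rewrite exprS; lra.
- by apply: far; rewrite // ?Re_mid /h'; lra.
- by apply: far; rewrite // ?Re_mid /h'; lra.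
- by apply: far; rewrite // ?Re_mid /h'; lra.
Qed.

Lemma cderivable_cont f a : cderivable f a ->
  forall e : R, 0 < e -> exists2 d : R, 0 < d &
    forall z, cmod (z - a) < d -> cmod (f z - f a) <= e.
Proof.
move=> /cderivableP[l hl] e e0; have [d d0 hd] := hl 1 ltr01.
have l1 : 0 < cmod l + 1 by have := cmod_ge0 l; lra.
exists (Num.min d (e / (cmod l + 1))); first by rewrite lt_min d0 divr_gt0.
move=> z; rewrite lt_min => /andP[zd]; rewrite ltr_pdivlMr // => ze.
have -> : f z - f a = (f z - f a - l * (z - a)) + l * (z - a) by ring.
have := hd z zd; have := cmodD (f z - f a - l * (z - a)) (l * (z - a)).
by rewrite cmodM; lra.
Qed.

Lemma cderivable_bounded f a : cderivable f a ->
  exists2 d : R, 0 < d &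
    forall z, cmod (z - a) < d -> cmod (f z) <= cmod (f a) + 1.
Proof.
move=> /cderivable_cont /(_ 1 ltr01)[d d0 hd]; exists d => // z /hd.
by have := cmodD (f z - f a) (f a); rewrite subrK; lra.
Qed.

Definition diff_quotient f b z : C := (f z - f b) / (z - b).

(** Near b the quotient is close to the derivative, and at b itself it is 0 / 0 = 0. *)
Lemma diff_quotient_bounded f b : cderivable f b ->
  exists (d M : R), 0 < d /\ forall z, cmod (z - b) < d -> cmod (diff_quotient f b z) <= M.
Proof.
move=> /cderivableP[l hl]; have [d d0 hd] := hl 1 ltr01.
exists d, (cmod l + 1); split => // z zd; rewrite /diff_quotient.
have [->|zb] := eqVneq z b.
  by rewrite subrr mul0r cmod0; have := cmod_ge0 l; lra.
have zb0 : 0 < cmod (z - b) by rewrite cmod_gt0 subr_eq0.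
rewrite cmodM cmodV ler_pdivrMr // mulrDl.
have -> : f z - f b = l * (z - b) + (f z - f b - l * (z - b)) by ring.
by apply: le_trans (cmodD _ _) _; rewrite cmodM lerD // hd.
Qed.

Lemma cderivable_cst (k : C) a : cderivable (fun=> k) a.
Proof. exact: derivable_cst. Qed.

Lemma cderivable_id a : cderivable id a.
Proof. exact: derivable_id. Qed.

Lemma cderivableD f g a : cderivable f a -> cderivable g a ->
  cderivable (fun z => f z + g z) a.
Proof. exact: derivableD. Qed.

Lemma cderivableM f g a : cderivable f a -> cderivable g a ->
  cderivable (fun z => f z * g z) a.
Proof. exact: derivableM. Qed.

Lemma cderivableV f a : f a != 0 -> cderivable f a ->
  cderivable (fun z => (f z)^-1) a.
Proof. exact: derivableV. Qed.

Lemma cderivable_divl f a b z : cderivable f z -> z != b ->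
  cderivable (fun z => (f z - a) / (z - b)) z.
Proof.
move=> fz zb; apply: cderivableM.
  by apply: cderivableD; [exact: fz | exact: cderivable_cst].
apply: (@cderivableV (fun z => z - b)); first by rewrite subr_eq0.
by apply: cderivableD; [apply: cderivable_id | apply: cderivable_cst].
Qed.

End PuncturedGoursat.

(** * Winding of a square around a point *)

Section SquareEdges.
Variable R : realType.
Local Notation C := R[i].
Implicit Types (f g : C -> C) (a b c u v w z : C) (N : nat) (r : R).

(** Test the hull against the half-plane that is orthogonal to z - c. *)
Lemma hull_cmod (s : seq C) c r : 0 <= r ->
  (forall x, x \in s -> cmod (x - c) <= r) ->
  forall z, hull s z -> cmod (z - c) <= r.
Proof.
move=> r0 hs z hz; pose k := conjc (z - c).
have ck : cmod k = cmod (z - c) by rewrite /cmod normcJ.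
have kz : complex.Re (k * (z - c)) = cmod (z - c) ^+ 2.
  rewrite mulrC -sqr_normc -cmodE -rmorphXn //=.
have := hz k (cmod (z - c) * r + complex.Re (k * c)).
have -> : k * z = k * (z - c) + k * c by ring.
rewrite raddfD /= kz lerD2r expr2 => hk.
have {}hk : cmod (z - c) * cmod (z - c) <= cmod (z - c) * r.
  apply: hk => x /hs hx.
  have -> : k * x = k * (x - c) + k * c by ring.
  rewrite raddfD /= lerD2r; apply: le_trans (ler_norm _) _.
  by apply: le_trans (Re_le_cmod _) _; rewrite cmodM ck ler_wpM2l ?cmod_ge0.
have [z0|z0] := eqVneq (cmod (z - c)) 0; first by rewrite z0.
by move: hk; rewrite ler_pM2l // lt_def z0 cmod_ge0.
Qed.

Section Edge.
Variables (c b w : C) (r : R).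
Hypotheses (r0 : 0 < r) (w1 : cmod w = 1) (hb : cmod (b - c) <= r / 2).

(** For w = 1, i, -1, -i these are the corners of the square of half-width r around c. *)
Definition corner c w r : C := c + w * Complex r (- r).
Let u := corner c w r.
Let v := corner c (w * 'i%C) r.

(** The side of the square that starts at the corner of direction w. *)
Definition edge z : Prop :=
  exists2 y : R, `|y| <= r & z = c + w * Complex r y.

Lemma midclosed_edge : midclosed edge.
Proof.
move=> _ _ [y hy ->] [y' hy' ->]; exists ((y + y') / 2).
  by move: hy hy'; rewrite !ler_norml => /andP[? ?] /andP[? ?]; lra.
rewrite /mid; have -> : Complex r ((y + y') / 2) = mid (Complex r y) (Complex r y').
  rewrite /mid; apply: (mulIf (x := 2%:R)); first by rewrite pnatr_eq0.
  rewrite mulfVK ?pnatr_eq0 // mulr_natr mulr2n.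
  by apply/eqP; rewrite eq_complex /= eqxx /=; apply/eqP; field.
by rewrite /mid; field.
Qed.

Lemma edge_corner : edge u /\ edge v.
Proof.
split.
  by exists (- r) => //; rewrite normrN (ger0_norm (ltW r0)).
exists r; first by rewrite (ger0_norm (ltW r0)).
rewrite /v /corner -mulrA; congr (_ + _ * _).
by apply/eqP; rewrite eq_complex /=; apply/andP; split; apply/eqP; ring.
Qed.

Lemma dir_neq0 : w != 0.
Proof. by rewrite -cmod_gt0 w1. Qed.

Lemma edge_far z : edge z -> r <= cmod (z - c) <= 2 * r /\ r / 2 <= cmod (z - b).
Proof.
move=> [y hy zE].
have zc : cmod (z - c) = cmod (Complex r y).
  by rewrite zE addrC addKr cmodM w1 mul1r.
have h1 : r <= cmod (z - c).
  by rewrite zc; have := Re_le_cmod (Complex r y); rewrite /= (ger0_norm (ltW r0)).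
split; first (apply/andP; split=> //).
  by rewrite zc; apply: le_trans (cmod_le_ReIm _) _; rewrite /= (ger0_norm (ltW r0)); lra.
have := le_trans (le_trans h1 (cmod_tri b z c)) (lerD (lexx _) hb); lra.
Qed.

Lemma corner_sub : v - u = w * Complex 0 (2 * r).
Proof.
rewrite /u /v /corner -mulrA opprD addrACA subrr add0r -mulrBr; congr (_ * _).
by apply/eqP; rewrite eq_complex /=; apply/andP; split; apply/eqP; ring.
Qed.

(** Along each side of a square that contains b, arg (z - b) increases at a definite rate.  By the
    change of variable (z - b) / w the side is vertical, with real part X between r / 2 and
    3 r / 2 and imaginary part Y at most 3 r / 2 in absolute value, and then
    2 r X / (X^2 + Y^2) is at least 2 / 9.  The factor i turns this imaginary part into minus a
    real part. *)
Lemma edge_winding z : edge z ->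
  complex.Re ('i%C * (v - u) * (z - b)^-1) <= - (2 / 9).
Proof.
move=> [y hy zE].
pose t := w^-1 * (b - c).
have bE : b = c + w * t by rewrite /t mulVKf ?dir_neq0 // addrC subrK.
have ht : cmod t <= r / 2 by rewrite /t cmodM cmodV w1 invr1 mul1r.
have ht1 := le_trans (Re_le_cmod t) ht; have ht2 := le_trans (Im_le_cmod t) ht.
have -> : 'i%C * (v - u) * (z - b)^-1 =
    Complex (- (2 * r)) 0 * (Complex r y - t)^-1.
  rewrite corner_sub zE bE opprD addrACA subrr add0r -mulrBr invfM.
  have -> : Complex (- (2 * r)) 0 = 'i%C * Complex 0 (2 * r) :> C.
    by apply/eqP; rewrite eq_complex /=; apply/andP; split; apply/eqP; ring.
  have H (x1 x2 x3 : C) : x3 * (w * x1) * (w^-1 * x2) = x3 * x1 * x2.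
    by field; apply: dir_neq0.
  by rewrite H.
move: ht1 ht2; case: (t) => p q /=; rewrite !ler_norml => /andP[p1 p2] /andP[q1 q2].
move: hy; rewrite ler_norml => /andP[y1 y2].
set X := r - p; set Y := y - q.
have X1 : r / 2 <= X by rewrite /X; lra.
have X2 : X <= 3 / 2 * r by rewrite /X; lra.
have Y1 : - (3 / 2 * r) <= Y by rewrite /Y; lra.
have Y2 : Y <= 3 / 2 * r by rewrite /Y; lra.
have X0 : 0 < X by move: r0; lra.
have D0 : 0 < X ^+ 2 + Y ^+ 2 by rewrite ltr_pwDl ?exprn_gt0 ?sqr_ge0.
have hX : X * X <= 3 / 2 * r * X by rewrite ler_pM2r.
have hY : 0 <= (3 / 2 * r - Y) * (3 / 2 * r + Y) by rewrite mulr_ge0 //; lra.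
have hr : r / 2 * r <= X * r by rewrite ler_pM2r.
rewrite mul0r subr0 mulNr lerN2 mulrA ler_pdivlMr // !expr2.
lra.
Qed.

End Edge.

End SquareEdges.

(** * The Cauchy bound *)

Section CauchyBound.
Variable R : realType.
Local Notation C := R[i].
Implicit Types (f g : C -> C) (a b c u v w z : C) (N : nat) (r : R).

(** The triangle spanned by b and one side of the square: differentiability fails at the
    vertex b only, and the difference quotient stays bounded there. *)
Lemma diff_quotient_edge f c b w r : 0 < r -> cmod w = 1 -> cmod (b - c) <= r / 2 ->
  (forall z, cmod (z - c) <= 2 * r -> cderivable f z) ->
  forall e : R, 0 < e ->
    eventually_le (diff_quotient f b) b (corner c w r) (corner c (w * 'i%C) r) e.
Proof.
move=> r0 w1 hb hf.
have [eu ev] := edge_corner c w r0.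
set u := corner c w r in eu *; set v := corner c _ r in ev *.
have [hu _] := edge_far r0 w1 hb eu; have [hv _] := edge_far r0 w1 hb ev.
have hfb : cderivable f b by apply: hf; lra.
have [d [M [d0 hM]]] := diff_quotient_bounded hfb.
have w0 : w != 0 by rewrite -cmod_gt0 w1.
have onedge z : edge c w r z -> complex.Re (w^-1 * z) = complex.Re (w^-1 * c) + r.
  by move=> [y hy ->]; rewrite mulrDr mulKf // raddfD.
move=> e e0.
refine (@goursat_vertex R (diff_quotient f b) b u v w^-1 (complex.Re (w^-1 * c) + r) M d
  _ d0 hM _ _ _ e e0).
- move=> z hz zb; refine (@cderivable_divl R f (f b) b z (hf z _) zb).
  move: z hz {zb}; apply: hull_cmod; first lra.
  by move=> x; rewrite !inE => /or3P[] /eqP ->; lra.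
- rewrite -(subrK c b) mulrDr raddfD /= addrC ltrD2l.
  apply: le_lt_trans (ler_norm _) _; apply: le_lt_trans (Re_le_cmod _) _.
  by rewrite cmodM cmodV w1 invr1 mul1r; lra.
- by rewrite (onedge _ eu) lexx.
- by rewrite (onedge _ ev) lexx.
Qed.

(** A Cauchy estimate with a non-optimal constant.  Summing over the four triangles with
    apex b, the inner sides cancel and the sums of (f(z) - f(b)) / (z - b) along the square
    tend to 0.  So f(b) times the sum of 1 / (z - b), of modulus at least 4 * 2/9, is nearly
    the sum of f(z) / (z - b), of modulus at most 4 * 4 M; and 16 / (8/9) = 18. *)
Lemma cauchy_bound f c r (M : R) b : 0 < r ->
  (forall z, cmod (z - c) <= 2 * r -> cderivable f z) ->
  (forall z, r <= cmod (z - c) <= 2 * r -> cmod (f z) <= M) ->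
  cmod (b - c) <= r / 2 -> cmod (f b) <= 18 * M.
Proof.
move=> r0 hf hM hb.
have M0 : 0 <= M.
  apply: le_trans (cmod_ge0 (f (c + r%:C%C))) (hM _ _).
  by rewrite addrC addKr cmodR (ger0_norm (ltW r0)) lexx /=; lra.
pose K z := (z - b)^-1.
pose p w := corner c w r.
pose I g N w := (p (w * 'i%C) - p w) * tmean g N (p w) (p (w * 'i%C)).
have IK N w : cmod w = 1 -> complex.Re ('i%C * I K N w) <= - (2 / 9).
  move=> w1; have [eu ev] := edge_corner c w r0.
  rewrite /I mulrA; apply: (@tmean_mem R (edge c w r) (fun x =>
    complex.Re ('i%C * (p (w * 'i%C) - p w) * x) <= - (2 / 9))) => //.
  - exact: midclosed_edge.
  - exact: midclosed_Re.
  - by move=> z hz; apply: edge_winding hz.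
have IfK N w : cmod w = 1 -> cmod (I (fun z => f z * K z) N w) <= 4 * M.
  move=> w1; have [eu ev] := edge_corner c w r0.
  have -> : 4 * M = 2 * r * (2 / r * M) by field; rewrite gt_eqF.
  rewrite /I cmodM ler_pM ?cmod_ge0 //.
    rewrite corner_sub cmodM w1 mul1r.
    by apply: le_trans (cmod_le_ReIm _) _; rewrite /= normr0 add0r ger0_norm //; lra.
  apply: (@cmod_tmean R (edge c w r)) => //; first exact: midclosed_edge.
  move=> z hz; have [h1 h2] := edge_far r0 w1 hb hz.
  rewrite cmodM mulrC ler_pM ?cmod_ge0 //; last exact: hM.
  rewrite /K cmodV -[2 / r]invf_div lef_pV2 // posrE ?divr_gt0 //.
  by apply: lt_le_trans h2; rewrite divr_gt0.
have IF N w : I (diff_quotient f b) N w = I (fun z => f z * K z) N w - f b * I K N w.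
  rewrite /I (eq_tmean (g := fun z => f z * K z + (- f b) * K z)); last first.
    by move=> z; rewrite /diff_quotient /K; ring.
  by rewrite tmeanD tmeanZ; ring.
pose w1 : C := 'i%C; pose w2 := w1 * 'i%C; pose w3 := w2 * 'i%C.
have W : w3 * 'i%C = 1.
  by apply/eqP; rewrite eq_complex /=; apply/andP; split; apply/eqP; ring.
have n1 : cmod w1 = 1 by apply: cmod_i.
have n2 : cmod w2 = 1 by rewrite cmodM n1 ?cmod_i mulr1.
have n3 : cmod w3 = 1 by rewrite cmodM n2 ?cmod_i mulr1.
pose S g N := I g N 1 + I g N w1 + I g N w2 + I g N w3.
have SK N : 8 / 9 <= cmod (S K N).
  have : complex.Re ('i%C * S K N) <= - (8 / 9).
    rewrite /S !mulrDr !raddfD /=.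
    have := IK N _ (cmod1 R); have := IK N _ n1; have := IK N _ n2.
    by have := IK N _ n3; lra.
  have := Re_le_cmod ('i%C * S K N); rewrite cmodM cmod_i mul1r ler_norml.
  by move=> /andP[]; lra.
have S4 g N : cmod (S g N) <= cmod (I g N 1) + cmod (I g N w1) +
    cmod (I g N w2) + cmod (I g N w3).
  apply: le_trans (cmodD _ _) _; apply: lerD => //.
  by apply: le_trans (cmodD _ _) _; apply: lerD => //; apply: cmodD.
have SfK N : cmod (S (fun z => f z * K z) N) <= 16 * M.
  have := S4 (fun z => f z * K z) N.
  have := IfK N _ (cmod1 R); have := IfK N _ n1; have := IfK N _ n2.
  by have := IfK N _ n3; lra.
have SF (e : R) : 0 < e -> exists N, cmod (S (diff_quotient f b) N) <= 4 * e.
  move=> e0; have T w (hw : cmod w = 1) := diff_quotient_edge r0 hw hb hf e0.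
  have [N0 h0] := T _ (cmod1 R); have [N1 h1] := T _ n1.
  have [N2 h2] := T _ n2; have [N3 h3] := T _ n3.
  pose N := (N0 + N1 + N2 + N3)%N; exists N.
  have {}h0 := h0 N ltac:(lia); have {}h1 := h1 N ltac:(lia).
  have {}h2 := h2 N ltac:(lia); have {}h3 := h3 N ltac:(lia).
  have -> : S (diff_quotient f b) N = trisum (diff_quotient f b) N b (p 1) (p w1) +
      trisum (diff_quotient f b) N b (p w1) (p w2) + trisum (diff_quotient f b) N b (p w2) (p w3) +
      trisum (diff_quotient f b) N b (p w3) (p 1).
    rewrite /S /I /trisum mul1r -/w1 -/w2 -/w3 W.
    rewrite !(tmeanC (diff_quotient f b) N b); ring.
  rewrite mul1r -/w1 in h0; rewrite W in h3.
  have := cmodD (trisum (diff_quotient f b) N b (p 1) (p w1) +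
      trisum (diff_quotient f b) N b (p w1) (p w2) + trisum (diff_quotient f b) N b (p w2) (p w3))
      (trisum (diff_quotient f b) N b (p w3) (p 1)).
  have := cmodD (trisum (diff_quotient f b) N b (p 1) (p w1) +
      trisum (diff_quotient f b) N b (p w1) (p w2)) (trisum (diff_quotient f b) N b (p w2) (p w3)).
  have := cmodD (trisum (diff_quotient f b) N b (p 1) (p w1))
      (trisum (diff_quotient f b) N b (p w1) (p w2)).
  by rewrite /p /w3 /w2 /w1 in h0 h1 h2 h3 *; lra.
rewrite leNgt; apply/negP => hlt.
have [|N hN] := SF ((8 / 9 * cmod (f b) - 16 * M) / 8); first lra.
have : f b * S K N = S (fun z => f z * K z) N - S (diff_quotient f b) N.
  by rewrite /S !IF; ring.
move=> /(congr1 (@cmod R)); rewrite cmodM => hE.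
have := cmodB (S (fun z => f z * K z) N) (S (diff_quotient f b) N).
have : 8 / 9 * cmod (f b) <= cmod (f b) * cmod (S K N).
  by rewrite mulrC ler_wpM2l ?cmod_ge0.
have := SfK N; lra.
Qed.

End CauchyBound.

(** * A maximum principle off a finite set *)

Section MaximumPrinciple.
Variable R : realType.
Local Notation C := R[i].
Implicit Types (f g : C -> C) (a b c u v w z : C) (N : nat) (r : R).

Lemma cderivable_near f g a (d : R) : 0 < d ->
  (forall z, cmod (z - a) < d -> f z = g z) ->
  cderivable f a -> cderivable g a.
Proof.
move=> d0 hfg /cderivableP[l hl]; apply/cderivableP; exists l => e e0.
have [d1 d10 h1] := hl e e0; exists (Num.min d d1); first by rewrite lt_min d0.
move=> z; rewrite lt_min => /andP[zd zd1]; rewrite -!hfg ?subrr ?cmod0 //.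
exact: h1.
Qed.

Lemma cderivable_horner (p : {poly C}) a : cderivable (horner p) a.
Proof.
elim/poly_ind: p => [|p k IH].
  apply: (cderivable_near (f := fun=> 0) ltr01) => [z _|]; first by rewrite horner0.
  exact: cderivable_cst.
apply: (cderivable_near (f := fun z => p.[z] * z + k) ltr01) => [z _|].
  by rewrite hornerMXaddC.
apply: cderivableD; last exact: cderivable_cst.
by apply: cderivableM; [exact: IH | exact: cderivable_id].
Qed.

Lemma horner_bounded (p : {poly C}) r : 0 <= r ->
  exists2 K : R, 0 <= K & forall z, cmod z <= r -> cmod p.[z] <= K.
Proof.
move=> r0; elim/poly_ind: p => [|p k [K K0 hK]].
  by exists 0 => // z _; rewrite horner0 cmod0.
exists (K * r + cmod k); first by rewrite addr_ge0 ?mulr_ge0 ?cmod_ge0.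
move=> z zr; rewrite hornerMXaddC; apply: le_trans (cmodD _ _) _.
by rewrite lerD2r cmodM ler_pM ?cmod_ge0 ?hK.
Qed.

(** The derivative is 0; this is how a factor with a double zero removes a bounded singularity. *)
Lemma cderivable_quadratic g a (d K : R) : 0 < d -> g a = 0 ->
  (forall z, cmod (z - a) < d -> cmod (g z) <= K * cmod (z - a) ^+ 2) ->
  cderivable g a.
Proof.
move=> d0 ga hK; apply/cderivableP; exists 0 => e e0.
have K1 : 0 < `|K| + 1 by have := normr_ge0 K; lra.
exists (Num.min d (e / (`|K| + 1))); first by rewrite lt_min d0 divr_gt0.
move=> z; rewrite lt_min => /andP[zd]; rewrite ltr_pdivlMr // => ze.
rewrite ga mul0r !subr0; apply: le_trans (hK z zd) _.
rewrite expr2 mulrA ler_wpM2r ?cmod_ge0 //.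
have := ler_norm K; have := cmod_ge0 (z - a); nra.
Qed.

Lemma cderivableX f a n : cderivable f a -> cderivable (fun z => f z ^+ n) a.
Proof.
move=> fa; elim: n => [|n IH].
  apply: (cderivable_near (f := fun=> 1) ltr01) => [z _|]; first by rewrite expr0.
  exact: cderivable_cst.
apply: (cderivable_near (f := fun z => f z * f z ^+ n) ltr01) => [z _|].
  by rewrite exprS.
exact: cderivableM.
Qed.

Lemma le_of_geometric (p q x M : R) : 0 < p -> 0 <= M -> 0 <= x ->
  (forall k, p * x ^+ k <= q * M ^+ k) -> x <= M.
Proof.
move=> p0 M0 x0 h; rewrite leNgt; apply/negP => Mx.
have {}x0 : 0 < x by exact: le_lt_trans Mx.
have y0 : 0 <= M / x by rewrite divr_ge0 // ltW.
have y1 : `|M / x| < 1 by rewrite (ger0_norm y0) ltr_pdivrMr // mul1r.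
have /cvgrPdist_lt/(_ (p / (`|q| + 1))) := cvg_expr y1.
have q1 : 0 < `|q| + 1 by have := normr_ge0 q; lra.
rewrite divr_gt0 // => /(_ isT)[N _ /(_ N (leqnn N))] /=.
rewrite sub0r normrN (ger0_norm (exprn_ge0 N y0)).
rewrite expr_div_n ltr_pdivrMr ?exprn_gt0 // mulrAC ltr_pdivlMr // => hN.
have := h N; have := ler_norm q; have : 0 <= M ^+ N by rewrite exprn_ge0.
nra.
Qed.

(** Multiply the powers of f by the square of a polynomial W that vanishes on E: the result
    is differentiable everywhere, and the Cauchy bound gives
    |W(b)|^2 |f(b)|^k <= 18 K^2 M^k for every k, whence |f(b)| <= M. *)
Lemma max_principle_off (E : seq C) f c r (rho B M : R) b :
  0 < r -> 2 * r < rho -> 0 <= M ->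
  (forall z, z \notin E -> cmod (z - c) < rho -> cderivable f z) ->
  (forall z, z \notin E -> cmod (z - c) < rho -> cmod (f z) <= B) ->
  (forall z, z \notin E -> r <= cmod (z - c) <= 2 * r -> cmod (f z) <= M) ->
  b \notin E -> cmod (b - c) <= r / 2 -> cmod (f b) <= M.
Proof.
move=> r0 rrho M0 fder fB fM bE bc.
pose W := \prod_(e <- E) ('X - e%:P); pose h k z := W.[z] ^+ 2 * f z ^+ k.
have rootW z : (W.[z] == 0) = (z \in E).
  by have := root_prod_XsubC E z; rewrite /root.
have [K K0 hK] := horner_bounded W (r := cmod c + 2 * r)
  ltac:(by have := cmod_ge0 c; lra).
apply: (@le_of_geometric (cmod (W.[b]) ^+ 2) (18 * K ^+ 2)) => //.
- by rewrite exprn_gt0 // cmod_gt0 rootW.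
- exact: cmod_ge0.
move=> k; rewrite -!cmodX -cmodM -mulrA.
apply: (@cauchy_bound R (h k) c r) => //.
- move=> z zc; have zrho : cmod (z - c) < rho by apply: le_lt_trans rrho.
  have [zE|zE] := boolP (z \in E); last first.
    by apply: cderivableM; apply: cderivableX;
      [exact: cderivable_horner | exact: fder].
  have /factor_theorem[V VE] : root W z by rewrite /root rootW.
  have [L L0 hL] := horner_bounded V (r := cmod z + 1)
    ltac:(by have := cmod_ge0 z; lra).
  apply: (@cderivable_quadratic (h k) z (Num.min 1 (rho - cmod (z - c)))
    (L ^+ 2 * `|B| ^+ k)).
  + by rewrite lt_min ltr01 subr_gt0.
  + by rewrite /h; move: zE; rewrite -rootW => /eqP ->; rewrite expr0n mul0r.
  move=> y; rewrite lt_min ltrBrDr => /andP[y1 yrho].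
  have [yE|yE] := boolP (y \in E).
    rewrite /h; move: yE; rewrite -rootW => /eqP ->; rewrite expr0n mul0r cmod0.
    by rewrite !mulr_ge0 ?exprn_ge0 ?cmod_ge0.
  have yc : cmod (y - c) < rho by apply: le_lt_trans (cmod_tri z y c) yrho.
  rewrite /h VE hornerM hornerXsubC cmodM !cmodX cmodM exprMn.
  rewrite mulrAC ler_wpM2r ?exprn_ge0 ?cmod_ge0 //.
  rewrite ler_pM ?exprn_ge0 ?cmod_ge0 //.
    rewrite ler_sqr ?nnegrE ?cmod_ge0 //; apply: hL.
    by have := cmodD (y - z) z; rewrite subrK; lra.
  rewrite lerXn2r ?nnegrE ?cmod_ge0 ?normr_ge0 //.
  exact: le_trans (fB _ yE yc) (ler_norm B).
- move=> z zann; have [zE|zE] := boolP (z \in E).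
    rewrite /h; move: zE; rewrite -rootW => /eqP ->; rewrite expr0n mul0r cmod0.
    by rewrite !mulr_ge0 ?exprn_ge0.
  rewrite /h cmodM !cmodX ler_pM ?exprn_ge0 ?cmod_ge0 //.
    rewrite ler_sqr ?nnegrE ?cmod_ge0 //; apply: hK.
    by have := cmodD (z - c) c; rewrite subrK; case/andP: zann; lra.
  by rewrite lerXn2r ?nnegrE ?cmod_ge0 // fM.
Qed.
End MaximumPrinciple.

(** * Removable singularities *)

Section RemovableSingularities.
Variable R : realType.
Local Notation C := R[i].
Implicit Types (f g : C -> C) (a b c u v w z : C) (N : nat) (r : R).

(** The difference quotient of f at b is bounded off the two points b and c, so the maximum
    principle bounds it by its size far from b. *)
Lemma bounded_lipschitz f c r (rho B : R) b b' : 0 < r -> 2 * r < rho ->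
  (forall z, 0 < cmod (z - c) < rho -> cderivable f z) ->
  (forall z, 0 < cmod (z - c) < rho -> cmod (f z) <= B) ->
  0 < cmod (b - c) <= r / 2 -> 0 < cmod (b' - c) <= r / 2 ->
  cmod (f b' - f b) <= 4 * B / r * cmod (b' - b).
Proof.
move=> r0 rrho fder fB /andP[b0 br] /andP[b'0 b'r].
have B0 : 0 <= B by apply: le_trans (cmod_ge0 (f b)) (fB b _); apply/andP; split; lra.
have [->|bb'] := eqVneq b' b; first by rewrite !subrr cmod0 mulr0.
have fb : cderivable f b by apply: fder; apply/andP; split; lra.
have [d1 [M1 [d10 hM1]]] := diff_quotient_bounded fb.
have notE z : z \notin [:: b; c] -> z != b /\ 0 < cmod (z - c).
  by rewrite !inE negb_or cmod_gt0 subr_eq0 => /andP[].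
have quotient_le (k : R) z : 0 < k -> k <= cmod (z - b) -> 0 < cmod (z - c) < rho ->
    cmod (diff_quotient f b z) <= 2 * B / k.
  move=> k0 kz zc; rewrite /diff_quotient cmodM cmodV ler_pM ?invr_ge0 ?cmod_ge0 //.
    have hb : cmod (f b) <= B by apply: fB; apply/andP; split; lra.
    by have := cmodB (f z) (f b); have := fB z zc; lra.
  by rewrite lef_pV2 // posrE; apply: lt_le_trans kz.
have bb0 : 0 < cmod (b' - b) by rewrite cmod_gt0 subr_eq0.
suff : cmod (diff_quotient f b b') <= 4 * B / r.
  by rewrite /diff_quotient cmodM cmodV ler_pdivrMr.
(* On the annulus |z - b| >= r / 2, which gives 2 B / (r / 2) = 4 B / r. *)
apply: (@max_principle_off R [:: b; c] (diff_quotient f b) c r rho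
  (Num.max M1 (2 * B / d1))).
- exact: r0.
- exact: rrho.
- by rewrite divr_ge0 ?mulr_ge0 // ltW.
- move=> z /notE[zb z0] zrho.
  refine (@cderivable_divl R f (f b) b z (fder z _) zb).
  by rewrite z0 zrho.
- move=> z /notE[zb z0] zrho; rewrite le_max.
  have [zd|zd] := ltP (cmod (z - b)) d1; first by rewrite hM1.
  by apply/orP; right; apply: quotient_le; rewrite // z0 zrho.
- move=> z /notE[zb z0] /andP[z1 z2].
  have -> : 4 * B / r = 2 * B / (r / 2) by field; rewrite gt_eqF.
  apply: quotient_le; rewrite ?divr_gt0 //; last by apply/andP; split; lra.
  by have := cmod_tri b z c; lra.
- by rewrite !inE negb_or bb' -subr_eq0 -cmod_gt0.
- exact: b'r.
Qed.

(** By the Lipschitz estimate the values of f along a dyadic sequence of points tending to c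
    converge, and the limit attracts all the values near c at a linear rate. *)
Lemma bounded_limit f c (rho B : R) : 0 < rho ->
  (forall z, 0 < cmod (z - c) < rho -> cderivable f z) ->
  (forall z, 0 < cmod (z - c) < rho -> cmod (f z) <= B) ->
  exists (l : C) (K : R), forall z, 0 < cmod (z - c) <= rho / 8 ->
    cmod (f z - l) <= K * cmod (z - c).
Proof.
move=> rho0 fder fB.
have [r [r0 hr hr8]] : exists r, [/\ 0 < r, 2 * r < rho & r / 2 = rho / 8].
  by exists (rho / 4); split; [lra | lra | field].
have lip b b' := bounded_lipschitz (b := b) (b' := b') r0 hr fder fB.
set K := 4 * B / r in lip.
pose p k : C := c + (r / 2 / 2 ^+ k)%:C%C.
have pc k : cmod (p k - c) = r / 2 / 2 ^+ k.
  rewrite /p addrC addKr cmodR ger0_norm // !divr_ge0 ?exprn_ge0 //; exact: ltW.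
have pin k : 0 < cmod (p k - c) <= r / 2.
  rewrite pc !divr_gt0 ?exprn_gt0 //= ler_pdivrMr ?exprn_gt0 //.
  by rewrite ler_peMr ?exprn_ege1 ?ler1n // divr_ge0 ?ltW.
have [|l hl] := @dyadic_limit R (fun k => f (p k)) (K * (r / 2)).
  move=> k; apply: le_trans (lip _ _ (pin k) (pin k.+1)) _.
  rewrite -mulrA (_ : cmod _ = r / 2 / 2 ^+ k.+1) //.
  rewrite /p opprD addrACA subrr add0r -rmorphB cmodR.
  have -> : r / 2 / 2 ^+ k.+1 - r / 2 / 2 ^+ k = - (r / 2 / 2 ^+ k.+1).
    rewrite exprS (invfM 2) (mulrA (r / 2)) (mulrAC (r / 2)).
    by move: (r / 2 / 2 ^+ k) => x; lra.
  by rewrite normrN ger0_norm // !divr_ge0 ?exprn_ge0 // ltW.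
exists l, K; rewrite -hr8 => z hz.
rewrite leNgt; apply/negP => hlt.
have [k hk] := dyadic_small (3 * (K * (r / 2))) (e := cmod (f z - l) - K * cmod (z - c))
  ltac:(lra).
have h1 := lip _ _ (pin k) hz; have h2 := hl k.
have K0 : 0 <= K.
  have B0 : 0 <= B.
    apply: le_trans (cmod_ge0 (f z)) (fB z _); case/andP: hz => -> /= h; lra.
  by rewrite /K divr_ge0 ?mulr_ge0 // ltW.
have h3 : K * cmod (z - p k) <= K * (cmod (z - c) + r / 2 / 2 ^+ k).
  by rewrite ler_wpM2l // -(pc k) (cmodC (p k) c) cmod_tri.
have h4 := cmod_tri (f (p k)) (f z) l.
have e1 : 3 * (K * (r / 2)) / 2 ^+ k = 3 * (K * (r / 2) / 2 ^+ k).
  by rewrite -[LHS]mulrA.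
have e2 : K * (cmod (z - c) + r / 2 / 2 ^+ k) =
   K * cmod (z - c) + K * (r / 2) / 2 ^+ k by rewrite mulrDr !mulrA.
by move: h1 h2 h3 h4 hk; rewrite e1 e2; lra.
Qed.

Definition patch f c l z : C := if z == c then l else f z.

Lemma patch_neq f c l z : z != c -> patch f c l z = f z.
Proof. by rewrite /patch => /negPf ->. Qed.

Lemma cderivable_patch f c l z : z != c -> cderivable f z ->
  cderivable (patch f c l) z.
Proof.
move=> zc; apply: (@cderivable_near R f (patch f c l) z (cmod (z - c))).
  by rewrite cmod_gt0 subr_eq0.
move=> y hy; rewrite patch_neq //; apply: contraTneq hy => ->.
by rewrite cmodC ltxx.
Qed.

(** Two applications of [bounded_limit]: f has a limit l at c with |f(z) - l| <= K |z - c|,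
    so (f(z) - l) / (z - c) is bounded and has a limit too, which is the derivative of the
    extension. *)
Theorem riemann_removable f c (rho B : R) : 0 < rho ->
  (forall z, 0 < cmod (z - c) < rho -> cderivable f z) ->
  (forall z, 0 < cmod (z - c) < rho -> cmod (f z) <= B) ->
  exists l, cderivable (patch f c l) c.
Proof.
move=> rho0 fder fB.
have [l [K hK]] := bounded_limit rho0 fder fB.
have [||m [L hL]] := @bounded_limit (fun z => (f z - l) / (z - c)) c (rho / 8) K
  ltac:(lra).
- move=> z /andP[z0 z8].
  refine (@cderivable_divl R f l c z (fder z _) _); last by rewrite -subr_eq0 -cmod_gt0.
  by rewrite z0; lra.
- move=> z /andP[z0 z8]; rewrite cmodM cmodV ler_pdivrMr //.
  by rewrite hK // z0 ltW.
exists l; apply/cderivableP; exists m => e e0.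
have L1 : 0 < `|L| + 1 by have := normr_ge0 L; lra.
exists (Num.min (rho / 64) (e / (`|L| + 1))).
  by rewrite lt_min !divr_gt0.
move=> z; rewrite lt_min => /andP[z1]; rewrite ltr_pdivlMr // => z2.
have [->|zc] := eqVneq z c; first by rewrite !subrr mulr0 subr0 cmod0 mulr0.
have z0 : 0 < cmod (z - c) by rewrite cmod_gt0 subr_eq0.
rewrite patch_neq // /patch eqxx.
have := hL z; have zr8 : cmod (z - c) <= rho / 8 / 8 by lra.
rewrite z0 zr8 => /(_ isT) {}hL.
have -> : f z - l - m * (z - c) = ((f z - l) / (z - c) - m) * (z - c).
  by field; rewrite subr_eq0.
rewrite cmodM ler_wpM2r ?cmod_ge0 //.
have LL := ler_norm L; have zz := cmod_ge0 (z - c).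
by apply: le_trans hL _; nra.
Qed.

End RemovableSingularities.

(** * Zeros, poles and polynomial growth *)

Section PolesAndGrowth.
Variable R : realType.
Local Notation C := R[i].
Implicit Types (f g : C -> C) (a b c u v w z : C) (N n : nat) (r : R).

Lemma cderivable_factor g c (rho : R) : 0 < rho ->
  (forall z, cmod (z - c) < rho -> cderivable g z) ->
  exists g1, (forall z, cderivable g z -> cderivable g1 z) /\
    forall z, g z = g c + (z - c) * g1 z.
Proof.
move=> rho0 gder.
have gc : cderivable g c by apply: gder; rewrite subrr cmod0.
have [d [M [d0 hM]]] := diff_quotient_bounded gc.
pose e := Num.min rho d.
have e0 : 0 < e by rewrite lt_min rho0.
have [||l hl] := @riemann_removable R (diff_quotient g c) c e M e0.
- move=> z /andP[z0]; rewrite lt_min => /andP[z1 _].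
  by refine (@cderivable_divl R g (g c) c z (gder z z1) _); rewrite -subr_eq0 -cmod_gt0.
- by move=> z /andP[z0]; rewrite lt_min => /andP[_ z1]; apply: hM.
exists (patch (diff_quotient g c) c l); split=> z.
  have [-> _|zc gz] := eqVneq z c; first exact: hl.
  exact: (@cderivable_patch R (diff_quotient g c) c l z zc (@cderivable_divl R g (g c) c z gz zc)).
have [->|zc] := eqVneq z c; first by rewrite subrr mul0r addr0.
by rewrite patch_neq // /diff_quotient; field; rewrite subr_eq0.
Qed.

(** If one could divide by z - c for ever, then g = (z - c)^n g_n for every n, with
    |g_n| <= B / r^n far from c.  The Cauchy bound gives |g(b)| <= 18 B (|b - c| / r)^n, hence
    g(b) = 0. *)
Lemma zero_order g c b r (rho B : R) : 0 < r -> 2 * r < rho ->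
  (forall z, cmod (z - c) < rho -> cderivable g z) ->
  (forall z, 0 < cmod (z - c) < rho -> cmod (g z) <= B) ->
  cmod (b - c) <= r / 2 -> g b != 0 ->
  exists n g1, [/\ cderivable g1 c, g1 c != 0 &
    forall z, g z = (z - c) ^+ n * g1 z].
Proof.
move=> r0 rrho gder gB br gb; apply: contrapT => hno.
have B0 : 0 <= B.
  apply: le_trans (cmod_ge0 (g (c + r%:C%C))) (gB _ _).
  by rewrite addrC addKr cmodR (ger0_norm (ltW r0)) r0 /=; lra.
have c0 : cmod (c - c) < rho by rewrite subrr cmod0; lra.
have rho0 : 0 < rho by lra.
have step n : exists2 gn, (forall z, cmod (z - c) < rho -> cderivable gn z) &
    forall z, g z = (z - c) ^+ n * gn z.
  elim: n => [|n [gn gnder gnE]].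
    by exists g => // z; rewrite expr0 mul1r.
  have gnc : gn c = 0.
    apply/eqP; apply: contrapT => /negP gnc; apply: hno; exists n, gn.
    by split; [exact: gnder | exact: gnc | exact: gnE].
  have [g1 [g1der g1E]] := cderivable_factor rho0 gnder.
  exists g1 => [z zc|z]; first exact: (g1der _ (gnder _ zc)).
  by rewrite gnE g1E gnc add0r exprSr mulrA.
suff : r <= cmod (b - c) by lra.
apply: (@le_of_geometric R (cmod (g b)) (18 * B)); rewrite ?cmod_gt0 ?cmod_ge0 ?ltW //.
move=> n; have [gn gnder gnE] := step n.
have rn : 0 < r ^+ n by rewrite exprn_gt0.
have h : cmod (gn b) <= 18 * (B / r ^+ n).
  apply: (@cauchy_bound R gn c r (B / r ^+ n) b r0).
  - by move=> z zr; apply: gnder; lra.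
  - move=> z /andP[z1 z2]; rewrite ler_pdivlMr //.
    have zc : 0 < cmod (z - c) by lra.
    apply: le_trans (_ : cmod (g z) <= _); last by apply: gB; rewrite zc /=; lra.
    rewrite gnE cmodM cmodX mulrC ler_wpM2r ?cmod_ge0 //.
    by rewrite lerXn2r ?nnegrE ?cmod_ge0 // ltW.
  - exact: br.
rewrite gnE cmodM cmodX.
have -> : 18 * B * cmod (b - c) ^+ n =
    cmod (b - c) ^+ n * (18 * (B / r ^+ n)) * r ^+ n.
  by field; rewrite gt_eqF.
apply: ler_wpM2r; first exact: ltW.
by rewrite ler_wpM2l // exprn_ge0 ?cmod_ge0.
Qed.

(** An isolated singularity that is at most a pole, in quantitative form. *)
Definition finite_order f a : Prop :=
  exists (n : nat) (K d : R), 0 < d /\ forall z, 0 < cmod (z - a) < d ->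
    cderivable f z /\ cmod (z - a) ^+ n * cmod (f z) <= K.

Lemma removable_finite_order f a : removable_at f a -> finite_order f a.
Proof.
move=> [g [/nbhs_cmodP[d1 d10 gder] /dnbhs_cmodP[d2 d20 gf]]].
have ga : cderivable g a by apply: gder; rewrite subrr cmod0.
have [d3 d30 hg] := cderivable_bounded ga.
exists 0, (cmod (g a) + 1), (Num.min d1 (Num.min d2 d3)).
split; first by rewrite !lt_min d10 d20.
move=> z; rewrite !lt_min => /and4P[z0 z1 z2 z3].
split; last by rewrite expr0 mul1r -(gf z z0 z2); exact: hg.
apply: (@cderivable_near R g f z (Num.min (cmod (z - a)) (d2 - cmod (z - a)))).
- by rewrite lt_min z0 subr_gt0.
- move=> y; rewrite lt_min ltrBrDr => /andP[y1 y2]; apply: gf.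
    have := cmod_tri y z a; rewrite (cmodC z y); lra.
  by have := cmod_tri z y a; lra.
- exact: (gder z z1).
Qed.

(** Near a pole the reciprocal of f is bounded by 1, so it extends to a as a function with a
    zero of some finite order n, and f is at most of the order of |z - a|^-n. *)
Lemma pole_finite_order f a : pole_at f a -> finite_order f a.
Proof.
move=> [/dnbhs_cmodP[d1 d10 fder]] /(_ [set x | 1 < x]).
have : nbhs (+oo : set_system R[i]) [set x : R[i] | 1 < x].
  by exists 1; split => //; exact: real1.
move=> h /(_ h) {h} /dnbhs_cmodP[d2 d20 fbig].
pose rho := Num.min d1 d2; have rho0 : 0 < rho by rewrite lt_min d10.
have {}fder z : 0 < cmod (z - a) < rho -> cderivable f z.
  by rewrite lt_min => /and3P[z0 z1 _]; exact: (fder z z0 z1).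
have {}fbig z : 0 < cmod (z - a) < rho -> 1 < cmod (f z).
  rewrite lt_min => /and3P[z0 _ z1]; rewrite -ltcR cmodE; exact: (fbig z z0 z1).
have fn0 z : 0 < cmod (z - a) < rho -> f z != 0.
  by move=> /fbig h; rewrite -cmod_gt0; lra.
pose h z := (f z)^-1.
have hder z : 0 < cmod (z - a) < rho -> cderivable h z.
  by move=> hz; exact: (cderivableV (fn0 z hz) (fder z hz)).
have hB z : 0 < cmod (z - a) < rho -> cmod (h z) <= 1.
  by move=> hz; have := fbig z hz; rewrite cmodV => hf; rewrite invf_le1; lra.
have [l hl] := riemann_removable rho0 hder hB.
set g := patch h a l in hl.
have gE z : 0 < cmod (z - a) -> g z = h z.
  by rewrite cmod_gt0 subr_eq0 => za; rewrite /g patch_neq.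
(* Any point other than a witnesses that g is not identically 0; take one at distance
   rho / 8. *)
have [||||||n [g1 [g1der g1a gfac]]] :=
  @zero_order g a (a + (rho / 8)%:C%C) (rho / 4) rho 1.
- by rewrite divr_gt0.
- lra.
- move=> z zr; have [->|za] := eqVneq z a; first exact: hl.
  have z0 : 0 < cmod (z - a) < rho by rewrite cmod_gt0 subr_eq0 za.
  exact: (@cderivable_patch R h a l z za (hder z z0)).
- by move=> z hz; rewrite gE; [exact: hB | case/andP: hz].
- by rewrite addrC addKr cmodR ger0_norm; lra.
- have p0 : 0 < cmod (a + (rho / 8)%:C%C - a) < rho.
    by rewrite addrC addKr cmodR ger0_norm; lra.
  by rewrite gE; [rewrite invr_eq0; exact: fn0 | case/andP: p0].
have ga2 : 0 < cmod (g1 a) / 2 by rewrite divr_gt0 // cmod_gt0.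
have [d3 d30 hg1] := cderivable_cont g1der ga2.
exists n, (2 / cmod (g1 a)), (Num.min rho d3); split; first by rewrite lt_min rho0.
move=> z; rewrite lt_min => /and3P[z0 zr z3].
have zz : 0 < cmod (z - a) < rho by rewrite z0.
split; first exact: fder.
have fE : f z = (g z)^-1 by rewrite gE // /h invrK.
have hz1 : cmod (g1 a) / 2 <= cmod (g1 z).
  by have := hg1 z z3; have := cmod_tri (g1 z) (g1 a) 0; rewrite !subr0 cmodC; lra.
rewrite fE gfac cmodV cmodM cmodX invfM mulVKf; last by rewrite expf_neq0 // gt_eqF.
by rewrite -[2 / _]invf_div lef_pV2 // posrE; lra.
Qed.

(** Induction on m: (f(z) - f(0)) / z is entire by the Riemann theorem and grows one degree
    less.  When |z f(z)| is bounded, the Cauchy bound on ever larger discs gives f = 0. *)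
Lemma liouville f (K R0 : R) m : (forall z, cderivable f z) ->
  (forall z, R0 <= cmod z -> cmod z * cmod (f z) <= K * cmod z ^+ m) ->
  exists p : {poly C}, forall z, f z = p.[z].
Proof.
elim: m f K R0 => [|m IH] f K R0 fder fK.
  exists 0 => b; rewrite horner0; apply/eqP; rewrite -cmod_eq0.
  rewrite eq_le cmod_ge0 andbT leNgt; apply/negP => fb0.
  (* A radius beyond R0 and 2 |b| for which the Cauchy bound 18 |K| / r is less than
     |f(b)|. *)
  pose r := `|R0| + cmod b * 2 + `|K| * 18 / cmod (f b) + 1.
  have r0 : 0 < r.
    by rewrite ltr_wpDl // !addr_ge0 ?mulr_ge0 ?invr_ge0 ?cmod_ge0 ?normr_ge0.
  have r1 : `|R0| + cmod b * 2 + `|K| * 18 / cmod (f b) < r by rewrite /r; lra.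
  have t0 : 0 <= `|K| * 18 / cmod (f b) by rewrite divr_ge0 ?mulr_ge0 ?cmod_ge0.
  have := cmod_ge0 b; have := normr_ge0 R0; have := ler_norm R0 => n1 n2 n3.
  have : cmod (f b) <= 18 * (`|K| / r).
    apply: (@cauchy_bound R f 0 r).
    - exact: r0.
    - by move=> z _; exact: fder.
    - move=> z; rewrite subr0 => /andP[z1 z2]; rewrite ler_pdivlMr // mulrC.
      apply: le_trans (_ : cmod z * cmod (f z) <= _).
        by rewrite ler_wpM2r ?cmod_ge0.
      have zR : R0 <= cmod z by lra.
      by apply: le_trans (fK z zR) _; rewrite expr0 mulr1 ler_norm.
    - by rewrite subr0; lra.
  rewrite mulrA ler_pdivlMr // mulrC -ler_pdivlMr //; lra.
have [g [gder gE]] := @cderivable_factor f 0 1 ltr01 (fun z _ => fder z).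
have [|p hp] := IH g (`|K| + cmod (f 0)) (Num.max R0 1) (fun z => gder z (fder z)).
  move=> z; rewrite ge_max => /andP[z1 z2].
  have z0 : 0 < cmod z by lra.
  have := fK z z1; rewrite exprS mulrCA ler_pM2l // => h.
  have -> : cmod z * cmod (g z) = cmod (f z - f 0).
    by rewrite gE subr0 addrC addKr cmodM.
  apply: le_trans (cmodB _ _) _; rewrite mulrDl; apply: lerD.
    by apply: le_trans h _; rewrite ler_wpM2r ?exprn_ge0 ?cmod_ge0 ?ler_norm.
  by rewrite ler_peMr ?cmod_ge0 ?exprn_ege1.
exists (p * 'X + (f 0)%:P) => z.
by rewrite hornerMXaddC -hp gE subr0 addrC mulrC.
Qed.

End PolesAndGrowth.

(** * Meromorphic functions on the sphere *)

Section RationalFunctions.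
Variable R : realType.
Local Notation C := R[i].
Implicit Types (f g : C -> C) (a b c u v w z : C) (N n : nat) (r : R).

Lemma cderivable_comp f g a : cderivable g a -> cderivable f (g a) ->
  cderivable (fun z => f (g z)) a.
Proof.
move=> /derivable1_diffP ga /derivable1_diffP fa; apply/derivable1_diffP.
exact: (differentiable_comp ga fa).
Qed.

Lemma cderivable_inv f w : w != 0 -> cderivable (fun w => f w^-1) w ->
  cderivable f w^-1.
Proof.
move=> w0 h; apply: (@cderivable_near R (fun z => f z^-1^-1) f _ 1 ltr01).
  by move=> z _; rewrite invrK.
apply: (@cderivable_comp (fun w => f w^-1) (fun z => z^-1)).
  by apply: (@cderivableV R id); [rewrite invr_eq0 | exact: cderivable_id].
by rewrite /= invrK.
Qed.

(** Bolzano-Weierstrass by bisection of squares: small squares near any point contain at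
    most that point of D. *)
Lemma discrete_bounded_finite (D : C -> Prop) (rho : R) :
  (forall a, exists2 d : R, 0 < d & forall z, 0 < cmod (z - a) < d -> ~ D z) ->
  (forall z, D z -> cmod z <= rho) ->
  exists s : seq C, forall z, D z <-> z \in s.
Proof.
move=> Ddisc Dbd.
pose P (t : C * R) := exists s : seq C, forall z,
  `|complex.Re (z - t.1)| <= t.2 -> `|complex.Im (z - t.1)| <= t.2 -> D z ->
  z \in s.
pose sgn (b : bool) : R := if b then 1 else - 1.
pose sub (t : C * R) (b b' : bool) : C * R :=
  (t.1 + Complex (sgn b * (t.2 / 2)) (sgn b' * (t.2 / 2)), t.2 / 2).
have sgn1 (b : bool) (x : R) : `|sgn b * x| = `|x|.
  by case: b; rewrite /sgn ?mulN1r ?mul1r ?normrN.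
suff [s hs] : P (0, rho).
  exists [seq z <- s | `[< D z >]] => z; rewrite mem_filter; split.
    move=> Dz; rewrite asboolT //=; apply: (hs z) => //; rewrite subr0.
      exact: le_trans (Re_le_cmod z) (Dbd z Dz).
    exact: le_trans (Im_le_cmod z) (Dbd z Dz).
  by case/andP => /asboolP.
apply: (@bisection R (C * R)%type fst (fun t => 2 * `|t.2|)
  (fun t t' => exists b b' : bool, t' = sub t b b')).
- move=> [c r] _ [b [b' ->]] /=; split.
    by rewrite normrM (ger0_norm (x := 2^-1)) ?invr_ge0 //; field.
  rewrite addrC addKr; apply: le_trans (cmod_le_ReIm _) _.
  by rewrite /= !sgn1 normrM (ger0_norm (x := 2^-1)) ?invr_ge0 //; lra.
- move=> [c r] h.
  have H (b b' : bool) := h (sub (c, r) b b') (ex_intro _ b (ex_intro _ b' erefl)).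
  have [s1 h1] := H true true; have [s2 h2] := H true false.
  have [s3 h3] := H false true; have [s4 h4] := H false false.
  (* The signs of the coordinates of z - c tell which quarter of the square contains z. *)
  exists (s1 ++ s2 ++ s3 ++ s4) => z /=; rewrite !mem_cat.
  move: (h1 z) (h2 z) (h3 z) (h4 z); rewrite /sub /sgn /= !mul1r !mulN1r.
  case: z c {h H h1 h2 h3 h4} => x y [x' y'] /=; rewrite !opprD => h1 h2 h3 h4.
  rewrite !ler_norml => /andP[p1 p2] /andP[q1 q2] Dz.
  have [hx|/ltW hx] := leP x' x; have [hy|/ltW hy] := leP y' y.
  + by rewrite h1 // ler_norml; lra.
  + by rewrite h2 ?orbT // ler_norml; lra.
  + by rewrite h3 ?orbT // ler_norml; lra.
  + by rewrite h4 ?orbT // ler_norml; lra.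
- move=> a; have [d d0 hd] := Ddisc a.
  exists (d / 3); first lra.
  move=> [c r] /= hc hr; exists [:: a] => z /= hx hy Dz; rewrite inE.
  rewrite -subr_eq0 -cmod_eq0 eq_le cmod_ge0 andbT leNgt; apply/negP => z0.
  apply: (hd z) Dz; rewrite z0 /=.
  have := cmod_tri c z a; have := cmod_le_ReIm (z - c).
  by have := ler_norm r; lra.
Qed.

Lemma horner_growth (p : {poly C}) :
  exists (n : nat) (K : R), 0 <= K /\
    forall z, 1 <= cmod z -> cmod p.[z] <= K * cmod z ^+ n.
Proof.
elim/poly_ind: p => [|p k [n [K [K0 hK]]]].
  by exists 0, 0; split=> // z _; rewrite horner0 cmod0 mul0r.
exists n.+1, (K + cmod k); split; first by rewrite addr_ge0 ?cmod_ge0.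
move=> z z1; rewrite hornerMXaddC; apply: le_trans (cmodD _ _) _.
rewrite mulrDl; apply: lerD; last by rewrite ler_peMr ?cmod_ge0 ?exprn_ege1.
by rewrite cmodM exprSr mulrA ler_wpM2r ?cmod_ge0 ?hK.
Qed.

Lemma finite_order_infty f : finite_order (fun w => f w^-1) 0 ->
  exists (n : nat) (K r : R), 0 < r /\ forall z, r < cmod z ->
    cderivable f z /\ cmod (f z) <= K * cmod z ^+ n.
Proof.
move=> [n [K [d [d0 h]]]]; exists n, K, d^-1; split; first by rewrite invr_gt0.
move=> z zd; have z0 : 0 < cmod z by apply: lt_trans zd; rewrite invr_gt0.
have [|hder hbd] := h z^-1.
  by rewrite subr0 cmodV invr_gt0 z0 /= -[d]invrK ltf_pV2 // posrE invr_gt0.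
have zn0 : z != 0 by rewrite -cmod_gt0.
split.
  rewrite -[z]invrK; apply: cderivable_inv; first by rewrite invr_eq0.
  exact: hder.
move: hbd; rewrite subr0 invrK cmodV exprVn mulrC ler_pdivrMr ?exprn_gt0 //.
Qed.

Lemma finite_order_seq f (s : seq C) :
  (forall a, a \in s -> finite_order f a) ->
  exists N0, forall N, (N0 <= N)%N -> forall a, a \in s ->
    exists (K d : R), 0 < d /\ forall z, 0 < cmod (z - a) < d ->
      cmod (z - a) ^+ N * cmod (f z) <= K.
Proof.
elim: s => [|a s IH] hs; first by exists 0.
have [|N1 h1] := IH; first by move=> b bs; apply: hs; rewrite inE bs orbT.
have [n [K [d [d0 hK]]]] := hs a (mem_head a s).
exists (maxn n N1) => N; rewrite geq_max => /andP[nN N1N] b.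
rewrite inE => /orP[/eqP ->|bs]; last exact: h1.
exists K, (Num.min d 1); split; first by rewrite lt_min d0 ltr01.
move=> z; rewrite lt_min => /and3P[z0 zd z1].
have [|_ h] := hK z; first by rewrite z0.
apply: le_trans h; apply: ler_wpM2r; first exact: cmod_ge0.
by apply: ler_wiXn2l => //; [exact: ltW | exact: ltW].
Qed.

(** With two more factors z - a than needed to bound f at the points a of s, the product
    vanishes there to second order and is therefore entire, also for the arbitrary values that
    f takes on s. *)
Lemma meromorphic_rational f (s : seq C) :
  (forall z, z \notin s -> cderivable f z) ->
  (forall a, a \in s -> finite_order f a) ->
  finite_order (fun w => f w^-1) 0 ->
  exists N0, forall N, (N0 <= N)%N -> exists p : {poly C}, forall z,
    (\prod_(a <- s) ('X - a%:P)).[z] ^+ N * f z = p.[z].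
Proof.
move=> fder ford finf; set W := \prod_(a <- s) _.
have rootW z : (W.[z] == 0) = (z \in s).
  by have := root_prod_XsubC s z; rewrite /root.
have [N0 hN0] := finite_order_seq ford.
exists N0.+2 => -[//|[//|N]]; rewrite !ltnS => N0N.
pose G z := W.[z] ^+ N.+2 * f z.
have Gder a : cderivable G a.
  have [aS|aS] := boolP (a \in s); last first.
    apply: cderivableM; last exact: fder.
    by apply: cderivableX; exact: cderivable_horner.
  have [K [d [d0 hK]]] := hN0 N N0N a aS.
  have /factor_theorem[V VE] : root W a by rewrite /root rootW.
  have [L L0 hL] := horner_bounded V (r := cmod a + 1)
    ltac:(by have := cmod_ge0 a; lra).
  apply: (@cderivable_quadratic R G a (Num.min 1 d) (L ^+ N.+2 * `|K|)).
  - by rewrite lt_min ltr01.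
  - by rewrite /G; move: aS; rewrite -rootW => /eqP ->; rewrite exprS !mul0r.
  move=> z; rewrite lt_min => /andP[z1 zd].
  have [->|za] := eqVneq z a.
    rewrite /G; move: aS; rewrite -rootW => /eqP ->; rewrite exprS !mul0r cmod0.
    by rewrite subrr cmod0 expr0n mulr0.
  have z0 : 0 < cmod (z - a) < d by rewrite cmod_gt0 subr_eq0 za.
  have h1 : cmod V.[z] ^+ N.+2 <= L ^+ N.+2.
    rewrite lerXn2r ?nnegrE ?cmod_ge0 //; apply: hL.
    by have := cmodD (z - a) a; rewrite subrK; lra.
  have h2 := le_trans (hK z z0) (ler_norm K).
  rewrite /G VE hornerM hornerXsubC cmodM cmodX cmodM exprMn.
  have -> : cmod V.[z] ^+ N.+2 * cmod (z - a) ^+ N.+2 * cmod (f z) =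
     cmod V.[z] ^+ N.+2 * (cmod (z - a) ^+ N * cmod (f z)) * cmod (z - a) ^+ 2.
    by rewrite -(addn2 N) !exprD; ring.
  apply: ler_wpM2r; first by rewrite exprn_ge0 ?cmod_ge0.
  apply: ler_pM h1 h2; first by rewrite exprn_ge0 ?cmod_ge0.
  by apply: mulr_ge0; rewrite ?exprn_ge0 ?cmod_ge0.
have [n [K [r [r0 hr]]]] := finite_order_infty finf.
have [m [L [L0 hL]]] := horner_growth (W ^+ N.+2).
have [|p hp] := @liouville R G (L * K) (Num.max 1 (r + 1)) (m + n).+1 Gder.
  move=> z; rewrite ge_max => /andP[z1 zr].
  have [|_ h] := hr z; first lra.
  rewrite exprS mulrCA ler_wpM2l ?cmod_ge0 // exprD mulrACA.
  rewrite /G cmodM -horner_exp ler_pM ?cmod_ge0 //; exact: hL.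
by exists p => z; rewrite -hp.
Qed.

End RationalFunctions.

(** * Meromorphic matrix functions *)

Section RationalMatrices.
Variables (R : realType) (n : nat).
Local Notation C := R[i].
Implicit Types (f : C -> C) (Q : C -> 'M[C]_n) (a z : C).

Lemma holomorphic_atP f a : holomorphic_at f a <->
  exists2 d : R, 0 < d & forall z, cmod (z - a) < d -> cderivable f z.
Proof. exact: nbhs_cmodP. Qed.

Lemma holomorphic_finite_order f a : holomorphic_at f a -> finite_order f a.
Proof.
move=> fa; apply: removable_finite_order; exists f; split => //.
by apply/dnbhs_cmodP; exists 1.
Qed.

(** The points where Q is not holomorphic are isolated and bounded, so there are finitely
    many; q is a power of the product of the z - a over these points, so that its zeros are
    exactly these points. *)
Lemma meromorphic_matrix_rational Q : mx_meromorphic_on_extended_plane Q ->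
  exists (q : {poly C}) (P : 'M[{poly C}]_n),
    (forall z, mx_holomorphic_at Q z <-> q.[z] != 0) /\
    forall z, q.[z] *: Q z = mx_horner P z.
Proof.
move=> [Qfin Qinf].
have ford a i j : finite_order (fun z => Q z i j) a.
  have [Qa|[Qa _]] := Qfin a; first exact: holomorphic_finite_order (Qa i j).
  by have [/removable_finite_order|/pole_finite_order] := Qa i j.
have finf i j : finite_order (fun w => Q w^-1 i j) 0.
  have [Qa|[Qa _]] := Qinf; first exact: removable_finite_order (Qa i j).
  by have [/removable_finite_order|/pole_finite_order] := Qa i j.
have hol_of z (d : R) : 0 < d ->
    (forall y, cmod (y - z) < d -> forall i j, cderivable (fun z => Q z i j) y) ->
    mx_holomorphic_at Q z.
  move=> d0 h i j; apply/holomorphic_atP; exists d => [//|y yd]; exact: (h y yd i j).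
have Qdisc a : exists2 d : R, 0 < d &
    forall z, 0 < cmod (z - a) < d -> ~ ~ mx_holomorphic_at Q z.
  have : \forall z \near (a : R[i]^o)^', forall ij : 'I_n * 'I_n,
      cderivable (fun z => Q z ij.1 ij.2) z.
    apply: filter_forall => -[i j] /=; apply/dnbhs_cmodP.
    have [m [K [d [d0 h]]]] := ford a i j; exists d => [//|z z0 zd].
    by case: (h z _) => //; rewrite z0.
  move=> /dnbhs_cmodP[d d0 h]; exists d => // z /andP[z0 zd]; apply.
  apply: (@hol_of z (Num.min (cmod (z - a)) (d - cmod (z - a)))).
    by rewrite lt_min z0 subr_gt0.
  move=> y; rewrite lt_min ltrBrDr => /andP[y1 y2] i j; apply: (h y _ _ (i, j)).
    by have := cmod_tri y z a; rewrite (cmodC z y); lra.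
  by have := cmod_tri z y a; lra.
have /choice[r hr] (ij : 'I_n * 'I_n) : exists r : R, 0 < r /\
    forall z, r < cmod z -> cderivable (fun z => Q z ij.1 ij.2) z.
  case: ij => i j.
  have [m [K [r [r0 h]]]] := @finite_order_infty R (fun z => Q z i j) (finf i j).
  by exists r; split=> [//|z /h[hz _]]; exact: hz.
have Qbd z : ~ mx_holomorphic_at Q z -> cmod z <= \sum_ij r ij.
  move=> Qz; rewrite leNgt; apply/negP => hz; apply: Qz.
  apply: (@hol_of z (cmod z - \sum_ij r ij)); first by rewrite subr_gt0.
  move=> y yz i j; have [rij0 hij] := hr (i, j); apply: hij.
  have : r (i, j) <= \sum_ij r ij.
    by rewrite (bigD1 (i, j)) //= lerDl sumr_ge0 // => ij _; case: (hr ij); lra.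
  by have := cmod_tri y z 0; rewrite !subr0 (cmodC z y); lra.
have [s hs] := discrete_bounded_finite Qdisc Qbd.
have goods z : z \notin s <-> mx_holomorphic_at Q z.
  split=> [zs|Qz]; first by apply: contrapT => /hs; exact/negP.
  by apply/negP => /hs.
have /choice[N0 hN0] (ij : 'I_n * 'I_n) : exists N0, forall N, (N0 <= N)%N ->
    exists p : {poly C}, forall z,
    (\prod_(a <- s) ('X - a%:P)).[z] ^+ N * Q z ij.1 ij.2 = p.[z].
  case: ij => i j.
  apply: (@meromorphic_rational R (fun z => Q z i j)); last exact: finf.
    move=> z /goods /(_ i j) /holomorphic_atP[d d0]; apply.
    by rewrite subrr cmod0.
  by move=> a _; exact: ford.
pose N := (\max_ij N0 ij).+1.
have /choice[P hP] (ij : 'I_n * 'I_n) : exists p : {poly C}, forall z,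
    (\prod_(a <- s) ('X - a%:P)).[z] ^+ N * Q z ij.1 ij.2 = p.[z].
  by apply: hN0; rewrite leqW // leq_bigmax.
exists ((\prod_(a <- s) ('X - a%:P)) ^+ N), (\matrix_(i, j) P (i, j)).
split=> z.
  rewrite horner_exp expf_eq0 /= -[_ == 0]/(root _ z) root_prod_XsubC.
  by split=> [/goods|/goods].
by apply/matrixP => i j; rewrite !mxE horner_exp -hP.
Qed.

End RationalMatrices.

(** * Existence of the Smith form *)

Section SmithForm.
Variable F : fieldType.
Local Notation P := {poly F}.

Definition elem_mx n (i j : 'I_n) (c : P) : 'M[P]_n := 1%:M + c *: delta_mx i j.

Lemma elem_mx_unit n (i j : 'I_n) c : i != j -> elem_mx i j c \in unitmx.
Proof.
move=> ij; have : elem_mx i j c *m elem_mx i j (- c) = 1%:M.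
  rewrite /elem_mx mulmxDl mul1mx mulmxDr mulmx1 -scalemxAl -scalemxAr.
  rewrite mul_delta_mx_0 1?eq_sym // !scaler0 addr0 -addrA -scalerDl.
  by rewrite addNr scale0r addr0.
by case/mulmx1_unit.
Qed.

Lemma elem_mxE n (i j : 'I_n) c (A : 'M[P]_n) l :
  (elem_mx i j c *m A) i l = A i l + c * A j l.
Proof.
rewrite /elem_mx mulmxDl mul1mx -scalemxAl mxE; congr (_ + _).
rewrite mxE; congr (_ * _); rewrite mxE (bigD1 j) //= mxE !eqxx mul1r.
by rewrite big1 ?addr0 // => k kj; rewrite mxE (negPf kj) andbF mul0r.
Qed.

(** A pivot that no sequence of row and column operations can improve. *)
Definition size_minimal n (A : 'M[P]_n) i j :=
  A i j != 0 /\ forall L M i' j', L \in unitmx -> M \in unitmx ->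
    (L *m A *m M) i' j' != 0 -> (size (A i j) <= size ((L *m A *m M) i' j'))%N.

Lemma size_minimal_tr n (A : 'M[P]_n) i j :
  size_minimal A i j -> size_minimal A^T j i.
Proof.
move=> [A0 hA]; split=> [|L M i' j' Lu Mu]; first by rewrite mxE.
have := hA M^T L^T j' i'; rewrite !unitmx_tr => /(_ Mu Lu).
have -> : M^T *m A *m L^T = (L *m A^T *m M)^T.
  by rewrite !trmx_mul trmxK mulmxA.
by rewrite [_^T j' i']mxE [A^T j i]mxE.
Qed.

Lemma size_minimal_equiv n (A L M : 'M[P]_n) i j i' j' :
  size_minimal A i j -> L \in unitmx -> M \in unitmx ->
  (L *m A *m M) i' j' = A i j -> size_minimal (L *m A *m M) i' j'.
Proof.
move=> [A0 hA] Lu Mu AE; rewrite /size_minimal AE; split=> // L' M' a b L'u M'u.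
have -> : L' *m (L *m A *m M) *m M' = (L' *m L) *m A *m (M *m M').
  by rewrite !mulmxA.
by apply: hA; rewrite unitmx_mul ?L'u ?Mu.
Qed.

(** Otherwise subtracting a multiple of row i from row k would leave the remainder of the
    division, an entry of smaller size. *)
Lemma size_minimal_dvd_col n (A : 'M[P]_n) i j k :
  size_minimal A i j -> A i j %| A k j.
Proof.
have [->|ki] := eqVneq k i; first by rewrite dvdpp.
move=> [A0 hA]; have := hA (elem_mx k i (- (A k j %/ A i j))) 1%:M k j.
rewrite elem_mx_unit // unitmx1 mulmx1 elem_mxE => /(_ isT isT).
have -> : A k j + - (A k j %/ A i j) * A i j = A k j %% A i j.
  by rewrite {1}(divp_eq (A k j) (A i j)); ring.
rewrite /dvdp => h; apply/negPn/negP => /h.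
by rewrite leqNgt ltn_modp A0.
Qed.

(** Adding a suitable multiple of row i to row k makes the entry (k, j) equal to the pivot;
    the pivot then divides row k of the new matrix as well as row i. *)
Lemma size_minimal_dvd n (A : 'M[P]_n) i j k l :
  size_minimal A i j -> A i j %| A k l.
Proof.
move=> hA; have rowdvd (B : 'M[P]_n) a b c : size_minimal B a b -> B a b %| B a c.
  by move=> /size_minimal_tr hB; have := size_minimal_dvd_col c hB; rewrite !mxE.
have [->|ki] := eqVneq k i; first exact: rowdvd.
(* With this c, A k j + (1 - c) * A i j = A i j. *)
pose c := A k j %/ A i j.
pose B := elem_mx k i (1 - c) *m A *m 1%:M.
have BE a : B k a = A k a + (1 - c) * A i a by rewrite /B mulmx1 elem_mxE.
have Bkj : B k j = A i j.
  by rewrite BE -[A k j](divpK (size_minimal_dvd_col k hA)) -/c; ring.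
have hB : size_minimal B k j.
  by apply: size_minimal_equiv Bkj; rewrite ?elem_mx_unit ?unitmx1.
have := rowdvd _ _ _ l hB; rewrite Bkj BE.
by rewrite dvdp_addl // dvdp_mull // rowdvd.
Qed.

Lemma exists_size_minimal n (A : 'M[P]_n) : A != 0 ->
  exists L M i j, [/\ L \in unitmx, M \in unitmx & size_minimal (L *m A *m M) i j].
Proof.
move=> A0.
pose good k := `[< exists L M i j, [/\ L \in unitmx, M \in unitmx,
  (L *m A *m M) i j != 0 & size ((L *m A *m M) i j) = k] >].
have ex : exists k, good k.
  have [i [j Aij]] : exists i j, A i j != 0.
    apply: contrapT => h; move/eqP: A0; apply; apply/matrixP => i j; rewrite mxE.
    by apply/eqP; apply: contrapT => /negP Aij; apply: h; exists i, j.
  exists (size (A i j)); apply/asboolP; exists 1%:M, 1%:M, i, j.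
  by rewrite mulmx1 mul1mx unitmx1.
case: (ex_minnP ex) => k /asboolP[L [M [i [j [Lu Mu A0' sz]]]]] kmin.
exists L, M, i, j; split=> //; split=> // L' M' i' j' L'u M'u h.
rewrite sz; apply: kmin; apply/asboolP; exists (L' *m L), (M *m M'), i', j'.
by rewrite !unitmx_mul Lu Mu L'u M'u; move: h; rewrite !mulmxA.
Qed.

(** Move an entry g of least size to the corner.  It divides all the entries; factor it out,
    clear the first row and column, and apply induction to what remains. *)
Theorem smith_form n (A : 'M[P]_n) :
  exists L M (d : 'rV[P]_n), [/\ L \in unitmx, M \in unitmx,
    L *m A *m M = diag_mx d & forall i j : 'I_n, (i <= j)%N -> d 0 i %| d 0 j].
Proof.
elim: n A => [|n IH] A.
  by exists 1%:M, 1%:M, 0; split; rewrite ?unitmx1 //;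
    [apply/matrixP => -[] | case].
have [->|A0] := eqVneq A 0.
  exists 1%:M, 1%:M, 0; rewrite unitmx1 mulmx0 mul0mx; split=> //.
    by apply/matrixP => i j; rewrite !mxE mul0rn.
  by move=> i j _; rewrite !mxE dvdp0.
have [L0 [M0 [i [j [L0u M0u hmin]]]]] := exists_size_minimal A0.
set A1 := L0 *m A *m M0 in hmin.
pose L1 : 'M[P]_n.+1 := tperm_mx i ord0; pose M1 : 'M[P]_n.+1 := tperm_mx j ord0.
pose A2 := xcol j ord0 (xrow i ord0 A1).
pose g := A1 i j.
have g0 : g != 0 by case: hmin.
have A2E : A2 = L1 *m A1 *m M1 by rewrite /A2 xcolE xrowE.
have A2xE k l : A2 k l = A1 (tperm i ord0 k) (tperm j ord0 l).
  by rewrite mxE [LHS]mxE.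
have gA2 k l : g %| A2 k l by rewrite A2xE; apply: size_minimal_dvd.
have A200 : A2 ord0 ord0 = g by rewrite A2xE !tpermR.
pose B : 'M[P]_(1 + n) := map_mx (fun p => p %/ g) A2.
have A2B : A2 = g *: B.
  by apply/matrixP => k l; rewrite [RHS]mxE [X in g * X]mxE mulrC divpK // gA2.
pose u := ursubmx B; pose v := dlsubmx B; pose C := drsubmx B.
have BE : B = block_mx 1%:M u v C.
  rewrite -[LHS]submxK; congr block_mx; apply/matrixP => a b; rewrite !ord1 2!mxE.
  have -> : lshift n (0 : 'I_1) = ord0 by apply: val_inj.
  by rewrite mxE A200 divpp // mxE.
pose L2 : 'M[P]_(1 + n) := block_mx 1%:M 0 (- v) 1%:M.
pose M2 : 'M[P]_(1 + n) := block_mx 1%:M (- u) 0 1%:M.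
have L2u : L2 \in unitmx by rewrite unitmxE det_lblock !det1 mulr1 unitr1.
have M2u : M2 \in unitmx by rewrite unitmxE det_ublock !det1 mulr1 unitr1.
have redB : L2 *m B *m M2 = block_mx 1%:M 0 0 (C - v *m u).
  rewrite BE !mulmx_block !mul1mx !mulmx1 !mul0mx !mulmx0 !addr0 ?add0r.
  by rewrite !addNr mul0mx !add0r mulNmx mul1mx addNr addrC.
have [L3 [M3 [d [L3u M3u redC dchain]]]] := IH (C - v *m u).
pose L4 : 'M[P]_(1 + n) := block_mx 1%:M 0 0 L3.
pose M4 : 'M[P]_(1 + n) := block_mx 1%:M 0 0 M3.
exists (L4 *m L2 *m L1 *m L0), (M0 *m M1 *m M2 *m M4).
exists (g *: (row_mx 1%:M d : 'rV[P]_(1 + n))).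
have L4u : L4 \in unitmx by rewrite unitmxE det_lblock det1 mul1r -unitmxE.
have M4u : M4 \in unitmx by rewrite unitmxE det_lblock det1 mul1r -unitmxE.
split.
- by rewrite !unitmx_mul L4u L2u L0u unitmx_perm.
- by rewrite !unitmx_mul M4u M2u M0u unitmx_perm.
- have -> : L4 *m L2 *m L1 *m L0 *m A *m (M0 *m M1 *m M2 *m M4) =
            L4 *m (L2 *m (L1 *m A1 *m M1) *m M2) *m M4 by rewrite /A1 !mulmxA.
  rewrite -A2E A2B -scalemxAr -scalemxAl redB -scalemxAr -scalemxAl.
  have dE : diag_mx (row_mx 1%:M d) = block_mx 1%:M 0 0 (diag_mx d) :> 'M[P]_(1 + n).
    rewrite diag_mx_row; congr block_mx.
    by apply/matrixP => a b; rewrite !ord1 !mxE.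
  rewrite [RHS]linearZ /= dE; congr (_ *: _).
  by rewrite /L4 /M4 !mulmx_block !mul1mx !mulmx1 !mul0mx !mulmx0 !addr0 ?add0r redC mul0mx.
- have gE (w : 'rV[P]_n.+1) c : (g *: w) 0 c = g * w 0 c by rewrite mxE.
  move=> a b ab; rewrite !gE dvdp_mul2l //; move: ab.
  have wl (c : 'I_1) : (row_mx 1%:M d : 'rV[P]_n.+1) 0 (lshift n c) = 1.
    by rewrite (ord1 c); apply: etrans (row_mxEl _ _ _ _) _; rewrite mxE.
  have wr c : (row_mx 1%:M d : 'rV[P]_n.+1) 0 (rshift 1 c) = d 0 c.
    exact: row_mxEr.
  case: (@split_ordP 1 n a) => a' ->; case: (@split_ordP 1 n b) => b' -> ab.
  - by rewrite !wl dvdpp.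
  - by rewrite wl dvd1p.
  - by move: ab; rewrite (ord1 b').
  - by rewrite !wr; apply: dchain.
Qed.
End SmithForm.

(** * Uniqueness of the Smith form *)

Section SmithUnique.
Variable F : fieldType.
Local Notation P := {poly F}.

(** Pad both factors to square matrices, the first one with a zero column. *)
Lemma det_mulmx_thin (K : comNzRingType) k (A : 'M[K]_(k.+1, k)) (B : 'M[K]_(k, k.+1)) :
  \det (A *m B) = 0.
Proof.
pose A' : 'M[K]_(k.+1, 1 + k) := row_mx 0 A; pose B' : 'M[K]_(1 + k, k.+1) := col_mx 0 B.
have -> : A *m B = (A' : 'M_k.+1) *m B'.
  by rewrite [RHS](@mul_row_col _ k.+1 1 k) mul0mx add0r.
rewrite det_mulmx (expand_det_col _ ord0) big1 ?mul0r // => i _.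
have -> : A' i ord0 = 0; last by rewrite mul0r.
have -> : ord0 = lshift k (ord0 : 'I_1) by apply: val_inj.
by rewrite row_mxEl mxE.
Qed.

Lemma det_congr_dvdp k (p : P) (A B : 'M[P]_k) :
  (forall i j, p %| A i j - B i j) -> p %| \det A - \det B.
Proof.
move=> h; rewrite -sumrB; apply: (big_ind (dvdp p)) => [|x y|s _]; first exact: dvdp0.
  exact: dvdp_add.
rewrite -mulrBr dvdp_mull //.
elim/big_rec2: _ => [|i x y _ hxy]; first by rewrite subrr dvdp0.
have -> : A i (s i) * y - B i (s i) * x =
  A i (s i) * (y - x) + (A i (s i) - B i (s i)) * x by ring.
by apply: dvdp_add; [exact: dvdp_mull | apply: dvdp_mulr; exact: h].
Qed.

(** A substitute for Cauchy-Binet.  For i <= k the entry e_i divides e_k, so scaling the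
    rows of X turns the leading block of size k + 1 into e_k times the identity.  On the other
    side, the entries d_l with l >= k are multiples of d_k, and the others contribute a product
    of a (k + 1) x k and a k x (k + 1) matrix.  Hence det (e_k - d_k Z) = 0 for some polynomial
    matrix Z.  After division by g = gcd (e_k, d_k) this reads det (e' - d' Z) = 0, so d'
    divides e'^(k+1); as d' and e' are coprime, d' is constant. *)
Lemma diag_factor_dvdp n (d e : 'I_n -> P) (X Y : 'M[P]_n) :
  (forall i j : 'I_n, (i <= j)%N -> d i %| d j) ->
  (forall i j : 'I_n, (i <= j)%N -> e i %| e j) ->
  diag_mx (\row_i e i) = X *m diag_mx (\row_i d i) *m Y ->
  forall k, d k %| e k.
Proof.
move=> dch ech E k.
have [ek0|ek0] := eqVneq (e k) 0; first by rewrite ek0 dvdp0.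
pose io := widen_ord (ltn_ord k : (k < n)%N) : 'I_k.+1 -> 'I_n.
have iok i : (io i <= k)%N by have := ltn_ord i; rewrite ltnS.
pose t (i : 'I_k.+1) l j := (e k %/ e (io i)) * X (io i) l * Y l (io j).
have Eij i j : e k *+ (i == j) = \sum_l t i l j * d l.
  have /matrixP/(_ (io i) (io j)) := E; rewrite !mxE => h.
  have -> : e k *+ (i == j) = (e k %/ e (io i)) * (e (io i) *+ (io i == io j)).
    have -> : (io i == io j) = (i == j).
      by apply/eqP/eqP => [/(congr1 val)/= /val_inj|->].
    by rewrite mulrnAr divpK // ech.
  rewrite h mulr_sumr; apply: eq_bigr => l _.
  rewrite mul_mx_diag !mxE /t; ring.
pose g := gcdp (e k) (d k).
have g0 : g != 0 by rewrite gcdp_eq0 negb_and ek0.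
pose e' := e k %/ g; pose d' := d k %/ g.
have eE : e k = e' * g by rewrite divpK // dvdp_gcdl.
have dE : d k = d' * g by rewrite divpK // dvdp_gcdr.
have cop : coprimep d' e' by rewrite coprimep_sym coprimep_div_gcd // ek0.
pose Z i j := \sum_(l < n | (k <= l)%N) t i l j * (d l %/ d k).
pose M := \matrix_(i < k.+1, j < k.+1) (e' *+ (i == j) - d' * Z i j).
have detM : \det M = 0.
  suff : \det (g *: M) = 0.
    by rewrite detZ => /eqP; rewrite mulf_eq0 expf_eq0 (negPf g0) andbF => /eqP.
  pose ik := widen_ord (ltnW (ltn_ord k)).
  have -> : g *: M = (\matrix_(i < k.+1, l < k) ((e k %/ e (io i)) * X (io i) (ik l))) *m
      (\matrix_(l < k, j < k.+1) (Y (ik l) (io j) * d (ik l))).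
    apply/matrixP => i j; rewrite !mxE mulrBr mulrnAr [g * e']mulrC -eE Eij.
    rewrite mulrA [g * d']mulrC -dE (bigID (fun l : 'I_n => (k <= l)%N)) /=.
    rewrite mulr_sumr.
    rewrite (eq_bigr (fun l => d k * (t i l j * (d l %/ d k)))); last first.
      by move=> l kl; rewrite mulrCA [d k * _]mulrC divpK // dch.
    rewrite addrAC subrr add0r.
    rewrite (eq_bigl (fun l : 'I_n => (l < k)%N)); last by move=> l; rewrite -ltnNge.
    rewrite (big_ord_narrow (ltnW (ltn_ord k))); apply: eq_bigr => l _.
    by rewrite !mxE /t -/ik; ring.
  exact: det_mulmx_thin.
have h : d' %| e' ^+ k.+1.
  have := @det_congr_dvdp k.+1 d' (e'%:M) M; rewrite det_scalar detM subr0; apply.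
  move=> i j; rewrite !mxE opprB addrC subrK dvdp_mulr //.
have d1 : size d' == 1%N.
  have := coprimep_expr k.+1 cop; rewrite /coprimep.
  by rewrite (eqp_size (dvdp_gcd_idl h)).
rewrite dE eE dvdp_mul2r // /dvdp.
by move: d1; rewrite size_poly_eq1 => d1; rewrite -/(dvdp _ _) (eqp_dvdl _ d1) dvd1p.
Qed.

Lemma sort_by_size n (e : 'I_n -> P) :
  exists s : 'S_n, forall i j : 'I_n, (i <= j)%N -> (size (e (s i)) <= size (e (s j)))%N.
Proof.
pose r := relpre (fun i => size (e i)) leq.
have rtr : transitive r by move=> x y z; apply: leq_trans.
have rtot : total r by move=> x y; apply: leq_total.
pose t := sort_tuple r (ord_tuple n).
have /tuple_permP[s st] : perm_eq t (ord_tuple n) by rewrite /= perm_sort.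
exists s => i j ij.
have tE k : tnth t k = s k.
  by rewrite (tnth_nth i) st (nth_map k) ?size_enum_ord // nth_ord_enum tnth_ord_tuple.
have := sort_sorted rtot (ord_tuple n).
move/(sorted_leq_nth rtr (fun x => leqnn _) i) => /(_ i j).
rewrite !inE size_sort size_tuple !ltn_ord => /(_ isT isT ij).
by rewrite /r /= -!tE !(tnth_nth i).
Qed.

(** Comparable nonzero polynomials are ordered by divisibility as soon as they are ordered
    by size. *)
Lemma sorted_comparable_chain n (e : 'I_n -> P) : (forall i, e i != 0) ->
  (forall i j, e i %| e j \/ e j %| e i) ->
  exists s : 'S_n, forall i j : 'I_n, (i <= j)%N -> e (s i) %| e (s j).
Proof.
move=> e0 cmp; have [s hs] := sort_by_size e; exists s => i j ij.
have [//|h] := cmp (s i) (s j).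
have := dvdp_leq (e0 (s i)) h; have := hs i j ij => h1 h2.
by have : e (s j) %= e (s i); [rewrite -dvdp_size_eqp // eqn_leq h1 h2 | case/andP].
Qed.

(** The two diagonal matrices are equivalent, so [diag_factor_dvdp] applies in both directions
    once e is sorted. *)
Lemma smith_form_unique n (d e : 'I_n -> P) (L M : 'M[P]_n) :
  (forall i j : 'I_n, (i <= j)%N -> d i %| d j) ->
  (forall i, e i != 0) -> (forall i j, e i %| e j \/ e j %| e i) ->
  L \in unitmx -> M \in unitmx ->
  diag_mx (\row_i e i) = L *m diag_mx (\row_i d i) *m M ->
  exists s : 'S_n, forall i, e i %= d (s i).
Proof.
move=> dch e0 cmp Lu Mu E.
have [s ech] := sorted_comparable_chain e0 cmp.
pose es i := e (s i).
have esE : diag_mx (\row_i es i) = perm_mx s *m diag_mx (\row_i e i) *m perm_mx s^-1.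
  rewrite -col_permE -row_permE; apply/matrixP => i j; rewrite !mxE.
  by rewrite (inj_eq perm_inj).
have eE : diag_mx (\row_i e i) = perm_mx s^-1 *m diag_mx (\row_i es i) *m perm_mx s.
  rewrite esE !mulmxA -perm_mxM mulVg perm_mx1 mul1mx -mulmxA -perm_mxM mulVg.
  by rewrite perm_mx1 mulmx1.
have dE : diag_mx (\row_i d i) = invmx L *m diag_mx (\row_i e i) *m invmx M.
  by rewrite E !mulmxA mulVmx // mul1mx mulmxK.
exists s^-1%g => i.
have key k : es k %= d k.
  apply/andP; split.
    apply: (@diag_factor_dvdp n es d (invmx L *m perm_mx s^-1) (perm_mx s *m invmx M)) => //.
    by rewrite dE eE !mulmxA.
  apply: (@diag_factor_dvdp n d es (perm_mx s *m L) (M *m perm_mx s^-1)) => //.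
  by rewrite esE E !mulmxA.
by have := key (s^-1%g i); rewrite /es permKV.
Qed.

End SmithUnique.

(** * Diagonal forms *)

Section DiagonalForms.
Variables (R : realType) (n : nat).
Local Notation C := R[i].
Implicit Types (Q : C -> 'M[C]_n) (S T A : 'M[{poly C}]_n) (z : C).

Lemma unitmx_const_det S : S \in unitmx <-> const_nonzero_det S.
Proof.
rewrite /const_nonzero_det unitmxE poly_unitE; split.
  by case/andP => /size_poly1P[c c0 ->] _; exists c.
move=> [c c0 ->]; rewrite size_polyC c0 coefC /=; by rewrite unitfE.
Qed.

Lemma mx_hornerM S T z : mx_horner (S *m T) z = mx_horner S z *m mx_horner T z.
Proof. exact: (map_mxM (horner_eval z)). Qed.

Lemma det_mx_horner S z : \det (mx_horner S z) = (\det S).[z].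
Proof. exact: (det_map_mx (horner_eval z)). Qed.

Lemma poly_eq_generic (p1 p2 h : {poly C}) : h != 0 ->
  (forall z, h.[z] != 0 -> p1.[z] = p2.[z]) -> p1 = p2.
Proof.
move=> h0 e; apply/eqP; rewrite -subr_eq0.
have : (p1 - p2) * h == 0.
  apply: contrapT => /negP/closed_nonrootP[z]; rewrite /root hornerM => /negP; apply.
  have [->|hz] := eqVneq h.[z] 0; first by rewrite mulr0.
  by rewrite hornerD hornerN e // subrr mul0r.
by rewrite mulf_eq0 (negPf h0) orbF.
Qed.

Lemma ratfun_dvd_common_den (q p1 q1 e1 p2 q2 e2 : {poly C}) :
  q != 0 -> q1 != 0 -> q2 != 0 -> p1 * q = q1 * e1 -> p2 * q = q2 * e2 ->
  ratfun_dvd p1 q1 p2 q2 <-> e1 %| e2.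
Proof.
move=> q0 q10 q20 E1 E2.
have k0 : q1 * q2 != 0 by rewrite mulf_neq0.
have H2 : p2 * q1 * q = q1 * q2 * e2 by rewrite [LHS]mulrAC E2; ring.
have H1 r : r * (p1 * q2) * q = q1 * q2 * (r * e1).
  by rewrite -[LHS]mulrA (mulrAC p1) E1; ring.
split=> [[r hr]|/dvdpP[r hr]].
  by apply/dvdpP; exists r; apply: (mulfI k0); rewrite -H1 -H2 hr.
by exists r; apply: (mulIf q0); rewrite H1 H2 hr.
Qed.

(** The identity of the diagonal form holds wherever q and the denominators do not vanish,
    hence as an identity of polynomials after clearing denominators; so S A T is diagonal. *)
Theorem diagonal_form_polynomial Q (q : {poly C}) A p' q' :
  (forall z, mx_holomorphic_at Q z <-> q.[z] != 0) ->
  (forall z, q.[z] *: Q z = mx_horner A z) -> q != 0 ->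
  diagonal_form Q p' q' ->
  exists S T (e : 'I_n -> {poly C}), [/\ S \in unitmx, T \in unitmx,
    S *m A *m T = diag_mx (\row_i e i) &
    forall i, p' i * q = q' i * e i].
Proof.
move=> Qhol QA q0 [q'0 [S [T [/unitmx_const_det Su /unitmx_const_det Tu D]]]].
pose U := S *m A *m T.
have UE i j : U i j * q' i = (p' i * q) *+ (i == j).
  apply: (@poly_eq_generic _ _ (q * \prod_k q' k)) => [|z].
    by rewrite mulf_neq0 //; apply/prodf_neq0 => k _; apply: q'0.
  rewrite hornerM mulf_eq0 negb_or horner_prod => /andP[qz /prodf_neq0 q'z].
  have q'z' k : (q' k).[z] != 0 by apply: q'z.
  have /matrixP/(_ i j) := D z ((Qhol z).2 qz) q'z'.
  have -> : mx_horner S z *m Q z *m mx_horner T z = q.[z]^-1 *: mx_horner U z.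
    rewrite /U !mx_hornerM -QA -scalemxAr -scalemxAl scalerA mulVf //.
    by rewrite scale1r.
  have -> : (diag_fun p' q' z) i j = ((p' i).[z] / (q' i).[z]) *+ (i == j).
    by rewrite !mxE.
  rewrite [RHS]mxE [X in _ = _ * X]mxE => h.
  have {}h : (U i j).[z] = q.[z] * ((p' i).[z] / (q' i).[z]) *+ (i == j).
    by rewrite -mulrnAr h mulVKf.
  rewrite hornerM hornerMn hornerM h mulrnAl; congr (_ *+ _).
  by field.
exists S, T, (fun i => U i i); split=> // [|i].
  apply/matrixP => i j; rewrite -/U [RHS]mxE [X in _ = X *+ _]mxE.
  have [<-|ij] := eqVneq i j; first by rewrite mulr1n.
  rewrite mulr0n; apply/eqP; have := UE i j; rewrite (negPf ij) mulr0n => /eqP.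
  by rewrite mulf_eq0 (negPf (q'0 i)) orbF.
by have := UE i i; rewrite eqxx mulr1n mulrC => ->.
Qed.

End DiagonalForms.

Theorem theorem2p3 (R : realType) (n : nat) (Q : R[i] -> 'M[R[i]]_n)
    (Q_meromorphic : mx_meromorphic_on_extended_plane Q)
    (det_Q_neq0 : det_not_identically_zero Q) :
  exists p q : 'I_n -> {poly R[i]},
    [/\ diagonal_form Q p q,
        divisibility_chain p q &
        forall p' q' : 'I_n -> {poly R[i]},
          diagonal_form Q p' q' -> divisibility_chain p' q' ->
          same_up_to_order_and_constants p q p' q'].
Proof.
have [q [A [Qhol QA]]] := meromorphic_matrix_rational Q_meromorphic.
have [z0 [Qz0 detQ]] := det_Q_neq0.
have q0 : q != 0.
  by apply: contraTneq ((Qhol z0).1 Qz0) => ->; rewrite horner0 eqxx.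
have detA : \det A != 0.
  apply: contraNneq detQ => detA0.
  have := congr1 determinant (QA z0).
  rewrite detZ det_mx_horner detA0 horner0 => /eqP.
  by rewrite mulf_eq0 expf_eq0 (negPf ((Qhol z0).1 Qz0)) andbF.
have [L [M [d [Lu Mu LAM dch]]]] := smith_form A.
have dE : diag_mx d = diag_mx (\row_i d 0 i).
  by congr diag_mx; apply/rowP => i; rewrite mxE.
exists (fun i => d 0 i), (fun=> q); split.
- split=> //; exists L, M; split; try exact/unitmx_const_det.
  move=> z /Qhol qz _.
  have -> : Q z = q.[z]^-1 *: mx_horner A z by rewrite -QA scalerA mulVf ?scale1r.
  rewrite -scalemxAr -scalemxAl -!mx_hornerM LAM.
  by apply/matrixP => i j; rewrite !mxE /ratfun hornerMn mulrnAr [_^-1 * _]mulrC.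
- move=> i j; have [ij|/ltnW ji] := leqP i j; [left | right];
    apply/(@ratfun_dvd_common_den R q (d 0 _) q _ (d 0 _) q _ q0 q0 q0); 
    by rewrite 1?mulrC // dch.
move=> p' q' D' ch'.
have q'0 : forall i, q' i != 0 by case: D'.
have [S [T [e [Su Tu SAT eE]]]] := diagonal_form_polynomial Qhol QA q0 D'.
have unit_det (B : 'M[{poly R[i]}]_n) : B \in unitmx -> \det B != 0.
  by rewrite unitmxE; apply: contraTneq => ->; rewrite unitr0.
have e0 i : e i != 0.
  have : \det (S *m A *m T) != 0 
    by rewrite !det_mulmx mulf_neq0 ?(unit_det T) // mulf_neq0 ?(unit_det S).
  by rewrite SAT det_diag => /prodf_neq0/(_ i isT); rewrite mxE.
have AE : A = invmx L *m diag_mx (\row_i d 0 i) *m invmx M.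
  by rewrite -dE -LAM !mulmxA mulVmx // mul1mx mulmxK.
have [||||s hs] := @smith_form_unique _ n (fun i => d 0 i) e (S *m invmx L)
  (invmx M *m T) dch e0.
- move=> i j.
  by case: (ch' i j) => [/(ratfun_dvd_common_den q0 (q'0 i) (q'0 j) (eE i) (eE j))
    | /(ratfun_dvd_common_den q0 (q'0 j) (q'0 i) (eE j) (eE i))]; [left | right].
- by rewrite unitmx_mul Su unitmx_inv.
- by rewrite unitmx_mul Tu unitmx_inv Mu.
- by rewrite -SAT [in LHS]AE !mulmxA.
have /choice[c hc] i : exists c, c != 0 /\ e i = c *: d 0 (s i).
  by have /eqpf_eq[c c0 eq] := hs i; exists c.
exists s, c; split=> [i|i z qz q'z]; first by case: (hc i).
have := congr1 (horner^~ z) (eE i).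
rewrite (hc i).2 !hornerM hornerZ /ratfun => h.
rewrite mulrA; apply: (mulIf qz); rewrite divfK //.
by apply: (mulfI q'z); rewrite -h; field.
Qed.
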